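(* The proof systems Q-resolution and $\mathsf{QCDCL}^{\textsf{LEV-ORD}}_{\textsf{RED}}$ (classical QCDCL) are incomparable: neither of them simulates the other. In other words, there is a family of false QCNFs with polynomial-size $\mathsf{QCDCL}^{\textsf{LEV-ORD}}_{\textsf{RED}}$ refutations but no polynomial-size Q-resolution refutations, and a family of false QCNFs with polynomial-size Q-resolution refutations but no polynomial-size $\mathsf{QCDCL}^{\textsf{LEV-ORD}}_{\textsf{RED}}$ refutations.
   Context: QBF basics. A literal is a variable $x$ or its negation $\bar x$; a clause is a disjunction of literals, identified with its set of literals; $(\bot)$ is the empty clause; a clause is tautological if it contains $x$ and $\bar x$ for some $x$. A QCNF is $\Phi=\mathcal{Q}\cdot\phi$ with prefix $\mathcal{Q}=Q_1X_1\dots Q_sX_s$ (pairwise disjoint nonempty variable sets $X_i$, $Q_i\in\{\exists,\forall\}$, $Q_i\ne Q_{i+1}$) and matrix $\phi$ a CNF of non-tautological clauses over these variables. For a variable or literal $x$ with variable in $X_i$ put $\mathrm{lv}(x)=i$; variables in $\exists$-blocks are existential, those in $\forall$-blocks universal. $\mathrm{red}(C)$ is obtained from a clause $C$ by deleting every universal literal $v\in C$ with $\mathrm{lv}(v)>\mathrm{lv}(x)$ for all existential literals $x\in C$. For an existential literal $\ell$ whose variable does not occur in $C_1,C_2$: $(C_1\vee\ell)\otimes_\ell(C_2\vee\bar\ell)=C_1\vee C_2$. A Q-resolution proof of $C$ from $\Phi$ is a sequence $C_1,\dots,C_m=C$ where each $C_i$ is in $\phi$, or a non-tautological resolvent $C_j\otimes_x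 C_k$ ($j,k<i$, $x$ existential), or $\mathrm{red}(C_j)$ ($j<i$); its size is $m$; a refutation is a proof of $(\bot)$. QCDCL. For a consistent set of literals $\sigma$, $C|_\sigma=\top$ if $C\cap\sigma\ne\emptyset$, otherwise $C|_\sigma$ is the clause of all $\ell\in C$ with $\bar\ell\notin\sigma$. A trail for $\Phi=\mathcal{Q}\cdot\phi$ is a sequence $\mathcal{T}=(p_{(0,1)},\dots,p_{(0,g_0)};d_1,p_{(1,1)},\dots,p_{(1,g_1)};\dots;d_r,p_{(r,1)},\dots,p_{(r,g_r)})$ of literals over the variables of $\Phi$ in which no variable occurs twice; $d_i$ are decision literals (existential or universal), $p_{(i,j)}$ are propagated literals (existential literals, or the symbol $\bot$, which may only be the last element, in which case $\mathcal{T}$ has run into a conflict). $\mathcal{T}[s,t]$ is the initial segment ending with $p_{(s,t)}$ (with $d_s$ if $t=0$; $\mathcal{T}[0,0]$ is empty), viewed as an assignment; $|\mathcal{T}|$ is the number of elements. Each propagated $p_{(i,j)}$ has an antecedent clause $\mathrm{ante}(p_{(i,j)})\in\phi$ with, under policy RED, $\mathrm{red}(\mathrm{ante}(p_{(i,j)})|_{\mathcal{T}[i,j-1]})=(p_{(i,j)})$, and under policy NO-RED, $\mathrm{ante}(p_{(i,j)})|_{\mathcal{T}[i,j-1]}=(p_{(i,j)})$ (where $(\bot)$ means the empty clause). Decision policy LEV-ORD: $\mathrm{lv}(d_i)\le\mathrm{lv}(x)$ for all variables $x$ of $\phi$ not assigned in $\mathcal{T}[i-1,g_{i-1}]$. A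 clause $C$ is unit under RED if $\mathrm{red}(C)=(x)$ with $x$ existential or $\mathrm{red}(C)$ is empty ($x=\bot$); under NO-RED if $C=(x)$ with $x$ existential or $C$ is empty. At an initial segment not containing $\bot$, the natural condition requires: if some clauses of the current clause set are unit under this segment, the next element is the literal $x$ of one of them, propagated with that clause as antecedent, and it is $\bot$ if one of these literals is $\bot$. A trail is natural if this holds at every initial segment. Learnable clauses: if $\mathcal{T}$ ends with $p_{(r,g_r)}=\bot$, set $C_{(r,g_r)}=\mathrm{red}(\mathrm{ante}(\bot))$ and, going leftwards over propagated literals $p=p_{(i,j)}$, with $C'$ the clause assigned to the next propagated literal to the right of $p$, set $C_{(i,j)}=\mathrm{red}(C'\otimes_p\mathrm{red}(\mathrm{ante}(p)))$ if $\bar p\in C'$ and $C_{(i,j)}=C'$ otherwise; $\mathcal{L}_\mathcal{T}$ is the sequence of these clauses, each coming with the derivation given by these steps. A $\mathsf{QCDCL}^{P}_{R}$ proof of $C$ from $\Phi$ is $\iota=((\mathcal{T}_1,\dots,\mathcal{T}_m),(C_1,\dots,C_m),(\pi_1,\dots,\pi_m))$ where each $\mathcal{T}_i$ is a trail following policies $P$ and $R$ for $\mathcal{Q}\cdot(\phi\cup\{C_1,\dots,C_{i-1}\})$ that has run into a conflict, $C_i\in\mathcal{L}_{\mathcal{T}_i}$ with derivation $\pi_i$, $C_m=C$, $\mathcal{T}_1$ is natural, and for each $i\ge2$ there is $(s,t)$ with $\mathcal{T}_i[s,t]=\mathcal{T}_{i-1}[s,t]$ such that $\mathcal{T}_i$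 satisfies the natural condition (w.r.t. $\phi\cup\{C_1,\dots,C_{i-1}\}$) at every initial segment extending $\mathcal{T}_i[s,t]$. It is a refutation if $C=(\bot)$; its size is $\sum_i|\mathcal{T}_i|$. A proof system $g$ (p-)simulates $f$ if every $f$-proof can be transformed (in polynomial time) into a $g$-proof of the same formula of size polynomial in the original. *)

(* Defs.v *)
From HB Require Import structures.
From mathcomp Require Import all_boot all_order all_algebra.

Set Implicit Arguments.
Unset Strict Implicit.
Unset Printing Implicit Defensive.

(* The literal [(x, true)] is x, and [(x, false)] is the negation of x. *)
Notation lit V := (V * bool)%type.
Notation clause V := {set V * bool}.

Definition neg_lit (V : finType) (l : lit V) : lit V := (l.1, ~~ l.2).

Definition tautological (V : finType) (C : clause V) : bool :=
  [exists l in C, neg_lit l \in C].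

Variant quantifier := Ex | All.

Definition is_ex (q : quantifier) : bool := if q is Ex then true else false.

Notation block V := (quantifier * {set V})%type.

(* The variables of a QCNF form a finite type, and the blocks of the prefix
   partition it. *)
Record qcnf := QCNF {
  qvar : finType;
  qprefix : seq (block qvar);
  qmatrix : {set clause qvar};
  qprefix_nonempty :
    all (fun b : block qvar => b.2 != set0) qprefix;
  qprefix_disjoint :
    pairwise (fun b c : block qvar => [disjoint b.2 & c.2])
      qprefix;
  qprefix_alternates :
    sorted (fun b c : block qvar => is_ex b.1 != is_ex c.1)
      qprefix;
  qprefix_covers : forall x : qvar,
    has (fun b : block qvar => x \in b.2) qprefix;
  qmatrix_nontaut : forall C : clause qvar,
    C \in qmatrix -> ~~ tautological C
}.

Definition lv (Phi : qcnf) (x : qvar Phi) : nat :=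
  (find (fun b : block (qvar Phi) => x \in b.2) (qprefix Phi)).+1.

Definition existential (Phi : qcnf) (x : qvar Phi) : bool :=
  has (fun b : block (qvar Phi) => is_ex b.1 && (x \in b.2)) (qprefix Phi).

Definition universal (Phi : qcnf) (x : qvar Phi) : bool :=
  has (fun b : block (qvar Phi) => ~~ is_ex b.1 && (x \in b.2)) (qprefix Phi).

Definition qcnf_size (Phi : qcnf) : nat :=
  #|qvar Phi| + #|qmatrix Phi| + \sum_(C in qmatrix Phi) #|C|.

Definition satisfies (V : finType) (a : V -> bool) (phi : {set clause V}) :
    Prop :=
  forall C, C \in phi -> exists2 l : lit V, l \in C & a l.1 = l.2.

Fixpoint prefix_holds (V : finType) (Q : seq (block V))
    (phi : {set clause V}) (a : V -> bool) : Prop :=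
  match Q with
  | [::] => satisfies a phi
  | (Ex, X) :: Q' => exists a' : V -> bool,
      (forall x, x \notin X -> a' x = a x) /\ prefix_holds Q' phi a'
  | (All, X) :: Q' => forall a' : V -> bool,
      (forall x, x \notin X -> a' x = a x) -> prefix_holds Q' phi a'
  end.

(* The initial assignment is irrelevant, as the prefix binds every variable. *)
Definition qcnf_true (Phi : qcnf) : Prop :=
  prefix_holds (qprefix Phi) (qmatrix Phi) (fun=> false).

Definition qcnf_false (Phi : qcnf) : Prop := ~ qcnf_true Phi.

Definition red (Phi : qcnf) (C : clause (qvar Phi)) : clause (qvar Phi) :=
  C :\: [set v | universal v.1 &
           [forall x in C, existential x.1 ==> (lv x.1 < lv v.1)]].

Definition resolvent (V : finType) (l : lit V) (C D : clause V) : clause V :=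
  (C :\ l) :|: (D :\ neg_lit l).

Definition resolvable (V : finType) (l : lit V) (C D : clause V) : bool :=
  [&& l \in C, neg_lit l \notin C, neg_lit l \in D & l \notin D].

Definition qres_proof (Phi : qcnf) (pi : seq (clause (qvar Phi)))
    (C : clause (qvar Phi)) : Prop :=
  (exists s, pi = rcons s C) /\
  forall s D s', pi = s ++ D :: s' ->
    [\/ D \in qmatrix Phi,
        exists C1 C2 l,
          [/\ C1 \in s, C2 \in s, existential l.1, resolvable l C1 C2 &
              D = resolvent l C1 C2 /\ ~~ tautological D]
      | exists2 C1, C1 \in s & D = red C1].

(* [None] encodes the restricted clause being the constant true. *)
Definition restrict (V : finType) (C : clause V) (sigma : {set lit V}) :
    option (clause V) :=
  if C :&: sigma == set0 then Some [set l in C | neg_lit l \notin sigma]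
  else None.

(* [Propagated (Some p) A] is the propagated literal p with antecedent A;
   [Propagated None A] is the conflict symbol with antecedent A. *)
Inductive trail_elt (V : finType) :=
  | Decision of lit V
  | Propagated of option (lit V) & clause V.
Arguments Decision {V}.
Arguments Propagated {V}.

Notation trail V := (seq (trail_elt V)).

Definition elt_lit (V : finType) (e : trail_elt V) : option (lit V) :=
  match e with Decision d => Some d | Propagated x _ => x end.

Definition trail_lits (V : finType) (T : trail V) : seq (lit V) :=
  pmap (@elt_lit V) T.

Definition trail_assignment (V : finType) (T : trail V) : {set lit V} :=
  [set l in trail_lits T].

(* A is unit, under RED, after the trail segment s, with literal x; x = None
   stands for the empty clause. *)
Definition unit_at (Phi : qcnf) (psi : {set clause (qvar Phi)})
    (s : trail (qvar Phi)) (x : option (lit (qvar Phi)))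
    (A : clause (qvar Phi)) : Prop :=
  A \in psi /\
  match x with
  | Some p => existential p.1 /\
      omap (@red Phi) (restrict A (trail_assignment s)) = Some [set p]
  | None => omap (@red Phi) (restrict A (trail_assignment s)) = Some set0
  end.

Definition is_trail (Phi : qcnf) (psi : {set clause (qvar Phi)})
    (T : trail (qvar Phi)) : Prop :=
  uniq [seq l.1 | l <- trail_lits T] /\
  forall s e s', T = s ++ e :: s' ->
    match e with
    | Decision d => forall C l, C \in psi -> l \in C ->
        l.1 \notin [seq m.1 | m <- trail_lits s] -> lv d.1 <= lv l.1
    | Propagated x A => unit_at psi s x A /\ (x = None -> s' = [::])
    end.

Definition has_conflict (V : finType) (T : trail V) : Prop :=
  exists s A, T = rcons s (Propagated None A).

Definition natural_at (Phi : qcnf) (psi : {set clause (qvar Phi)})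
    (s : trail (qvar Phi)) (e : trail_elt (qvar Phi)) : Prop :=
  (exists x A, unit_at psi s x A) ->
  exists x A, [/\ e = Propagated x A, unit_at psi s x A &
                  (exists B, unit_at psi s None B) -> x = None].

Definition natural_from (Phi : qcnf) (psi : {set clause (qvar Phi)})
    (k : nat) (T : trail (qvar Phi)) : Prop :=
  forall s e s', T = s ++ e :: s' -> k <= size s -> natural_at psi s e.

Definition elt_propagation (V : finType) (e : trail_elt V) :
    option (lit V * clause V) :=
  if e is Propagated (Some p) A then Some (p, A) else None.

(* Antecedents of p never contain the negation of p, and clauses learned to the
   right of p never contain p, so the resolution step is always a proper one. *)
Definition learn_step (Phi : qcnf) (C : clause (qvar Phi))
    (pA : lit (qvar Phi) * clause (qvar Phi)) : clause (qvar Phi) :=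
  let: (p, A) := pA in
  if neg_lit p \in C then red (resolvent p (red A) C) else C.

Definition learnable (Phi : qcnf) (T : trail (qvar Phi)) :
    seq (clause (qvar Phi)) :=
  if rev T is Propagated None A :: T' then
    red A :: scanl (@learn_step Phi) (red A) (pmap (@elt_propagation _) T')
  else [::].

(* Trails are compared as sequences of decision and propagated literals, which
   does not involve the antecedents. *)
Definition elt_skeleton (V : finType) (e : trail_elt V) :
    lit V + option (lit V) :=
  match e with Decision d => inl d | Propagated x _ => inr x end.

Definition same_segment (V : finType) (k : nat) (T T' : trail V) : Prop :=
  [/\ k <= size T, k <= size T' &
      [seq elt_skeleton e | e <- take k T] =
      [seq elt_skeleton e | e <- take k T']].

(* The derivation of a learned clause is determined by the trail and the
   position of the clause in [learnable], so it is not recorded. *)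
Definition qcdcl_proof (Phi : qcnf)
    (iota : seq (trail (qvar Phi) * clause (qvar Phi)))
    (C : clause (qvar Phi)) : Prop :=
  (exists s T, iota = rcons s (T, C)) /\
  forall s T D s', iota = s ++ (T, D) :: s' ->
    let psi := qmatrix Phi :|: [set B in unzip2 s] in
    [/\ is_trail psi T, has_conflict T, D \in learnable T,
        s = [::] -> natural_from psi 0 T
      & forall s0 T0 D0, s = rcons s0 (T0, D0) ->
          exists2 k, same_segment k T T0 & natural_from psi k T].

Definition qcdcl_size (Phi : qcnf)
    (iota : seq (trail (qvar Phi) * clause (qvar Phi))) : nat :=
  \sum_(TC <- iota) size TC.1.

Record proof_system := ProofSystem {
  ps_proof : qcnf -> Type;
  ps_refutes : forall Phi, ps_proof Phi -> Prop;
  ps_size : forall Phi, ps_proof Phi -> nat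
}.

Definition Qresolution : proof_system :=
  @ProofSystem (fun Phi => seq (clause (qvar Phi)))
    (fun Phi pi => qres_proof pi set0)
    (fun Phi pi => size pi).

Definition QCDCL_LEVORD_RED : proof_system :=
  @ProofSystem (fun Phi => seq (trail (qvar Phi) * clause (qvar Phi)))
    (fun Phi iota => qcdcl_proof iota set0)
    (fun Phi iota => qcdcl_size iota).

Definition simulates (g f : proof_system) : Prop :=
  exists p : {poly nat}, forall (Phi : qcnf) (pi : ps_proof f Phi),
    ps_refutes pi ->
    exists2 rho : ps_proof g Phi, ps_refutes rho &
      ps_size rho <= p.[ps_size pi]%R.

Definition poly_size_refutations (f : proof_system) (Phi : nat -> qcnf) :
    Prop :=
  exists p : {poly nat}, forall n,
    exists2 pi : ps_proof f (Phi n), ps_refutes pi &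
      ps_size pi <= p.[qcnf_size (Phi n)]%R.

(* Main.v *)
Require Import Defs.
From HB Require Import structures.
From mathcomp Require Import all_boot all_order all_algebra.
From mathcomp Require Import zify.

(** Both separating families have prefix exists X, forall U, exists T.

    QCDCL is stronger on the equality formulas with clauses
    (x_j, u_j, t_j), (-x_j, -u_j, t_j) and (u_n, -t_0, ..., -t_n), together with
    a unit clause t_n and guard clauses (-a_j, t_j) over fresh variables a_j of
    the first block. For every choice of the x_j, with all a_j false, the
    universal player has exactly one winning response. The first clause without
    T-literals of a Q-resolution refutation that is falsified on X by that choice
    must contain the whole response, and 2^n responses require 2^n clauses.
    QCDCL instead merges u_j and -u_j: deciding a_j true sets t_j before any
    universal variable is decided, so that u_j and -u_j become reducible, and two
    trails per index j eliminate t_j from the long clause.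

    Q-resolution is stronger on the clauses (x_i, u, t_i), (-x_i, u, t_i) and
    (u, -t_0, ..., -t_n): it resolves on the x_i first. In QCDCL every clause with
    a T-literal contains u, so no t_i is assigned before all of X is, and a
    literal of X is never propagated by a clause with T-literals. Hence each
    trail excludes at most one further assignment of X. *)

Set Implicit Arguments.
Unset Strict Implicit.
Unset Printing Implicit Defensive.

(** * Polynomial growth *)

Lemma horner_nat_sum (p : {poly nat}) (m : nat) :
  p.[m]%R = \sum_(i < size p) nth 0 p i * m ^ i.
Proof. by rewrite horner_coef; apply: eq_bigr => i _; rewrite natrXE. Qed.

Lemma horner_nat_le (p : {poly nat}) (m m' : nat) :
  m <= m' -> p.[m]%R <= p.[m']%R.
Proof.
move=> le_mm'; rewrite !horner_nat_sum; apply: leq_sum => i _.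
rewrite leq_mul2l; apply/orP; right.
by case: (nat_of_ord i) => [|e] //; rewrite leq_exp2r.
Qed.

(** For positive [m], each power [m ^ i] with [i < size p] is at most [m ^ size p], so the sum of
    the coefficients serves as [c]. *)
Lemma horner_nat_monomial_bound (p : {poly nat}) :
  exists c d, forall m, 0 < m -> p.[m]%R <= c * m ^ d.
Proof.
exists (\sum_(i < size p) nth 0 p i), (size p) => m m_gt0.
rewrite horner_nat_sum big_distrl /=; apply: leq_sum => i _.
by rewrite leq_mul2l leq_pexp2l ?orbT // ltnW.
Qed.

Lemma exp2_superpoly (e : nat) (p : {poly nat}) :
  exists n, p.[(2 ^ e * n.+1 ^ 2)%N]%R < 2 ^ n.
Proof.
have [c [d pP]] := horner_nat_monomial_bound p.
pose b := (c + e * d + 2 * d + 2)%N; pose j := (2 * b)%N.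
have lt_b : (b * (2 * j).+1 < 2 ^ (2 * j))%N.
  have lt_j : (j < 2 ^ j)%N by exact: ltn_expl.
  rewrite (mulnC 2 j) expnM; apply: (@leq_trans (j.+1 ^ 2)).
    by rewrite /j -mulnn; nia.
  by rewrite leq_exp2r.
(* With [n + 1 = 2 ^ (2 * j)] and [c] bounded by [2 ^ c], both sides are powers of two; the exponent
   [c + e * d + 4 * j * d] lies below [n + 1] by [lt_b]. *)
exists (2 ^ (2 * j)).-1; rewrite prednK ?expn_gt0 //.
apply: leq_ltn_trans (pP _ _) _; first by rewrite muln_gt0 !expn_gt0.
rewrite expnMn -!expnM.
have lt_c : (c < 2 ^ c)%N by exact: ltn_expl.
apply: (@leq_trans (2 ^ c * (2 ^ (e * d) * 2 ^ (2 * j * (2 * d))))).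
  by rewrite ltn_pmul2r ?muln_gt0 ?expn_gt0.
rewrite -!expnD leq_exp2l // -ltnS prednK ?expn_gt0 //.
by apply: leq_ltn_trans lt_b; rewrite /b; nia.
Qed.

(** A polynomial in the formula size is bounded by a polynomial in [n], which [2 ^ n] exceeds for
    some [n]. *)
Lemma not_poly_size_refutations (f : proof_system) (Phi : nat -> qcnf)
    (e : nat) :
  (forall n, qcnf_size (Phi n) <= 2 ^ e * n.+1 ^ 2) ->
  (forall n (pi : ps_proof f (Phi n)), ps_refutes pi -> 2 ^ n <= ps_size pi) ->
  ~ poly_size_refutations f Phi.
Proof.
move=> sizeP lower [p pP]; have [n lt_n] := exp2_superpoly e p.
have [pi /lower ge_pi le_pi] := pP n.
have := leq_trans (leq_trans ge_pi le_pi) (horner_nat_le p (sizeP n)).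
by rewrite leqNgt lt_n.
Qed.

(** A simulation would turn the short [f]-refutations into short [g]-refutations, with the composed
    polynomial as bound. *)
Lemma separation_not_simulates (f g : proof_system) (Phi : nat -> qcnf) :
  poly_size_refutations f Phi -> ~ poly_size_refutations g Phi ->
  ~ simulates g f.
Proof.
move=> [q qP] not_poly [p pP]; apply: not_poly; exists (p \Po q)%R => n.
have [pi /pP[rho rhoP le_rho] le_pi] := qP n; exists rho => //.
by rewrite horner_comp; apply: leq_trans le_rho (horner_nat_le _ le_pi).
Qed.

(** * Formulas with three quantifier blocks *)

Lemma cat_cons_rcons (T : Type) (s s' t : seq T) (x y : T) :
  rcons t y = s ++ x :: s' ->
  [/\ s = t, x = y & s' = [::]] \/ exists s'', t = s ++ x :: s''.
Proof.
case/lastP: s' => [|s' z].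
  by rewrite cats1 => /rcons_inj[-> ->]; left.
rewrite -rcons_cons -rcons_cat => /rcons_inj[-> _].
by right; exists s'.
Qed.

Lemma nontautological_of (V : finType) (a : V -> bool) (C : clause V) :
  (forall l, l \in C -> a l.1 = l.2) -> ~~ tautological C.
Proof.
move=> aC; apply/negP => /exists_inP[l lC /aC].
by rewrite /= (aC l lC); case: (l.2).
Qed.

Lemma nontautologicalP (V : finType) (C : clause V) (l : lit V) :
  ~~ tautological C -> l \in C -> neg_lit l \notin C.
Proof. by move=> ntC lC; apply: contra ntC => nlC; apply/exists_inP; exists l. Qed.

Lemma qcnf_size_bound (Phi : qcnf) (m : nat) :
  #|qmatrix Phi| <= m ->
  qcnf_size Phi <= #|qvar Phi| + m * (#|qvar Phi| * 2).+1.
Proof.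
move=> le_m; rewrite /qcnf_size -addnA leq_add2l.
apply: (@leq_trans (\sum_(C in qmatrix Phi) (#|qvar Phi| * 2).+1)).
  rewrite -sum1_card -big_split /=; apply: leq_sum => C _.
  by rewrite add1n ltnS (leq_trans (max_card _)) // card_prod card_bool.
by rewrite sum_nat_const leq_mul2r le_m orbT.
Qed.

Lemma resolventP (V : finType) (l m : lit V) (C D : clause V) :
  (m \in resolvent l C D) =
  (m != l) && (m \in C) || (m != neg_lit l) && (m \in D).
Proof. by rewrite !inE. Qed.

Section ThreeBlocks.

Variables (V : finType) (k : V -> nat) (phi : {set clause V}).

Definition level_block (i : nat) : {set V} := [set x | k x == i].

Hypothesis k_lt3 : forall x, k x < 3.
Hypothesis k_onto : forall i, i < 3 -> exists x, k x = i.
Hypothesis phi_nontaut : forall C, C \in phi -> ~~ tautological C.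

Definition three_prefix : seq (block V) :=
  [:: (Ex, level_block 0); (All, level_block 1); (Ex, level_block 2)].

Lemma three_prefix_nonempty :
  all (fun b : block V => b.2 != set0) three_prefix.
Proof.
have ne i : i < 3 -> level_block i != set0.
  by case/k_onto=> x <-; apply/set0Pn; exists x; rewrite inE.
by rewrite /= !ne.
Qed.

Lemma three_prefix_disjoint :
  pairwise (fun b c : block V => [disjoint b.2 & c.2]) three_prefix.
Proof.
have dis i j : i != j -> [disjoint level_block i & level_block j].
  move=> ne_ij; rewrite -setI_eq0; apply/eqP/setP=> x; rewrite !inE.
  by apply/negP=> /andP[/eqP->]; apply/negP.
by rewrite /= !dis.
Qed.

Lemma three_prefix_covers x :
  has (fun b : block V => x \in b.2) three_prefix.
Proof. by rewrite /= !inE; move: (k_lt3 x); case: (k x) => [|[|[|]]]. Qed.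

Definition three_block_qcnf : qcnf :=
  @QCNF V three_prefix phi three_prefix_nonempty three_prefix_disjoint
    isT three_prefix_covers phi_nontaut.

Local Notation Phi := three_block_qcnf.

Lemma lv3E (x : V) : @lv Phi x = (k x).+1.
Proof.
by rewrite /lv /= !inE; move: (k_lt3 x); case: (k x) => [|[|[|]]].
Qed.

Lemma existential3E (x : V) : @existential Phi x = (k x != 1).
Proof.
by rewrite /existential /= !inE; move: (k_lt3 x); case: (k x) => [|[|[|]]].
Qed.

Lemma universal3E (x : V) : @universal Phi x = (k x == 1).
Proof.
by rewrite /universal /= !inE; move: (k_lt3 x); case: (k x) => [|[|[|]]].
Qed.

(** A universal literal is kept only because of an existential literal further right, and in this
    prefix only the last block lies there. *)
Lemma mem_red3 (C : clause V) (l : lit V) :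
  (l \in @red Phi C) =
  (l \in C) && ((k l.1 != 1) || [exists t in C, k t.1 == 2]).
Proof.
rewrite !inE universal3E; case: (l \in C); rewrite ?andbF //= andbT.
case: (eqVneq (k l.1) 1) => //= kl; apply/idP/idP.
- rewrite negb_forall => /existsP[t]; rewrite !negb_imply existential3E !lv3E.
  case/and3P=> tC kt; rewrite kl -leqNgt => ge_t.
  apply/exists_inP; exists t => //.
  by move: (k_lt3 t.1) kt ge_t; case: (k t.1) => [|[|[|]]].
- case/exists_inP=> t tC /eqP kt; rewrite negb_forall; apply/existsP; exists t.
  by rewrite !negb_imply tC existential3E !lv3E kt kl.
Qed.

Lemma red3_id (C : clause V) (t : lit V) :
  t \in C -> k t.1 = 2 -> @red Phi C = C.
Proof.
move=> tC kt; apply/setP=> l; rewrite mem_red3 andb_idr // => _.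
by apply/orP; right; apply/exists_inP; exists t; rewrite ?kt.
Qed.

Lemma red3_sub (C : clause V) : @red Phi C \subset C.
Proof. exact: subsetDl. Qed.

(** The hypothesis is a winning strategy of the universal player: [b] carries the response to [a],
    and [c] ranges over the completions on the last block. *)
Lemma three_block_false :
  (forall a : V -> bool, exists2 b : V -> bool,
     forall x, k x != 1 -> b x = a x &
     forall c : V -> bool, (forall x, k x != 2 -> c x = b x) ->
       ~ satisfies c phi) ->
  qcnf_false Phi.
Proof.
move=> winP [a [_ /= allP]]; have [b ba bP] := winP a.
have [x|c [cb sat_c]] := allP b; first by rewrite inE => /ba.
by apply: (bP c) => // x kx; apply: cb; rewrite inE.
Qed.

(** * Unit and conflicting clauses under reduction *)

Section Units.

Variables (psi : {set clause V}) (s : trail V).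

Lemma mem_trail_assignment (l : lit V) :
  (l \in trail_assignment s) = (l \in trail_lits s).
Proof. by rewrite inE. Qed.

Lemma unit_some (A : clause V) (x : option (lit V)) :
  @unit_at Phi psi s x A ->
  exists D : clause V, [/\ A \in psi, [disjoint A & trail_assignment s],
    D =i [pred l in A | neg_lit l \notin trail_lits s] &
    @red Phi D = if x is Some p then [set p] else set0].
Proof.
case=> Apsi; rewrite /restrict; case: ifP => [/eqP AsE|_] unitA.
  exists [set l in A | neg_lit l \notin trail_assignment s]; split=> //.
  - by rewrite -setI_eq0; apply/eqP.
  - by move=> l; rewrite !inE.
  - by case: x unitA => [p [_ []]|[]].
by case: x unitA => [p []|].
Qed.

Lemma not_unit_of_sat (A : clause V) (x : option (lit V)) (l : lit V) :
  l \in A -> l \in trail_lits s -> ~ @unit_at Phi psi s x A.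
Proof.
move=> lA ls /unit_some[D [_ /pred0P/(_ l) /=]].
by rewrite lA mem_trail_assignment ls.
Qed.

Lemma not_conflict_of_unassigned (A : clause V) (l : lit V) :
  l \in A -> k l.1 != 1 -> neg_lit l \notin trail_lits s ->
  ~ @unit_at Phi psi s None A.
Proof.
move=> lA kl ls /unit_some[D [_ _ DE /setP/(_ l)]].
by rewrite mem_red3 DE !inE lA ls kl.
Qed.

Lemma not_unit_of_two (A : clause V) (x : option (lit V)) (l m : lit V) :
  l \in A -> m \in A -> l != m -> k l.1 != 1 -> k m.1 != 1 ->
  neg_lit l \notin trail_lits s -> neg_lit m \notin trail_lits s ->
  ~ @unit_at Phi psi s x A.
Proof.
move=> lA mA lm kl km ls ms /unit_some[D [_ _ DE /setP redD]].
have := redD l; have := redD m.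
rewrite !mem_red3 !DE !inE lA mA ls ms kl km /=.
case: x {redD} => [p|]; last by rewrite !inE.
by rewrite !inE => /esym/eqP mp /esym/eqP lp; rewrite lp mp eqxx in lm.
Qed.

(** The open last-block literal [t] prevents [l] from being reduced, so the restricted clause keeps
    two literals. *)
Lemma not_unit_of_blocked (A : clause V) (x : option (lit V)) (l t : lit V) :
  l \in A -> t \in A -> k l.1 = 1 -> k t.1 = 2 ->
  neg_lit l \notin trail_lits s -> neg_lit t \notin trail_lits s ->
  ~ @unit_at Phi psi s x A.
Proof.
move=> lA tA kl kt ls ts unitA; have [D [_ _ DE]] := unit_some unitA.
have tD : t \in D by rewrite DE !inE tA ts.
have lD : l \in D by rewrite DE !inE lA ls.
rewrite (red3_id tD kt) => DE'; move: tD lD; rewrite {}DE'.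
case: x {unitA} => [p|]; last by rewrite inE.
by rewrite !inE => /eqP tp /eqP lp; rewrite lp -tp kt in kl.
Qed.

(** A literal other than [p] disappears either by being falsified or by reduction; the latter needs
    a universal literal and is impossible while [p] itself lies in the last block. *)
Lemma unit_falsified (A : clause V) (p l : lit V) :
  @unit_at Phi psi s (Some p) A -> l \in A -> l != p ->
  (k l.1 != 1) || (k p.1 == 2) -> neg_lit l \in trail_lits s.
Proof.
move=> unitA lA lp kl; apply: contraT => ls.
have [D [_ _ DE redD]] := unit_some unitA.
have lD : l \in D by rewrite DE !inE lA ls.
have : l \notin [set p] by rewrite inE.
rewrite -redD mem_red3 lD /= negb_or => /andP[/negbTE kl1 noT].
move: kl; rewrite kl1 /= => kp; case/negP: noT; apply/exists_inP; exists p => //.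
by apply: (subsetP (red3_sub D)); rewrite redD inE.
Qed.

Lemma unit_mem (A : clause V) (p : lit V) :
  @unit_at Phi psi s (Some p) A -> p \in A /\ k p.1 != 1.
Proof.
move=> unitA; have [D [_ _ DE redD]] := unit_some unitA.
have /(subsetP (red3_sub D)) : p \in @red Phi D by rewrite redD inE.
by rewrite DE !inE => /andP[-> _]; case: unitA => _ []; rewrite existential3E.
Qed.

Lemma restrict_disjoint (A : clause V) :
  (forall l, l \in A -> l \notin trail_lits s) ->
  restrict A (trail_assignment s) =
  Some [set l in A | neg_lit l \notin trail_lits s].
Proof.
move=> disA; rewrite /restrict ifT; last first.
  rewrite -subset0; apply/subsetP=> l; rewrite !inE.
  by case/andP=> /disA/negbTE->.
by congr Some; apply/setP=> l; rewrite !inE.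
Qed.

(** The last condition mirrors [unit_falsified]: for a first-block [p] no last-block literal is
    left, so open universal literals are reduced away. *)
Lemma unit_intro (A : clause V) (p : lit V) :
  A \in psi -> p \in A -> k p.1 != 1 ->
  (forall l, l \in A -> l \notin trail_lits s) ->
  neg_lit p \notin trail_lits s ->
  (forall l, l \in A -> l != p ->
     neg_lit l \in trail_lits s \/ k l.1 = 1 /\ k p.1 != 2) ->
  @unit_at Phi psi s (Some p) A.
Proof.
move=> Apsi pA kp disA ps others; split=> //; split; first by rewrite existential3E.
rewrite restrict_disjoint //=; congr Some; apply/setP=> l.
rewrite mem_red3 !inE; apply/idP/eqP => [|->]; last by rewrite pA ps kp.
case/andP=> /andP[lA ls]; case: (eqVneq l p) => // lp.
have [nls|[-> kp2] /=] := others l lA lp; first by rewrite nls in ls.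
case/exists_inP=> t; rewrite !inE => /andP[tA ts] /eqP kt.
have [tp|/(others t tA)[nts|[kt1 _]]] := eqVneq t p.
- by rewrite -tp kt in kp2.
- by rewrite nts in ts.
- by rewrite kt in kt1.
Qed.

Lemma conflict_intro (A : clause V) :
  A \in psi -> (forall l, l \in A -> l \notin trail_lits s) ->
  (forall l, l \in A -> neg_lit l \in trail_lits s \/ k l.1 = 1) ->
  @unit_at Phi psi s None A.
Proof.
move=> Apsi disA fals; split=> //; rewrite restrict_disjoint //=; congr Some.
apply/setP=> l; rewrite mem_red3 !inE; apply/negP=> /andP[/andP[lA ls]].
have [nls|-> /=] := fals l lA; first by rewrite nls in ls.
case/exists_inP=> t; rewrite !inE => /andP[tA ts] /eqP kt.
by have [nts|kt1] := fals t tA; [rewrite nts in ts | rewrite kt in kt1].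
Qed.

End Units.
End ThreeBlocks.

Arguments red3_id {V k phi k_lt3 k_onto phi_nontaut C t}.
Arguments red3_sub {V k phi k_lt3 k_onto phi_nontaut} C.

(** * A family that is easy for QCDCL and hard for Q-resolution *)

Lemma qres_nontautological (Phi : qcnf) (pi : seq (clause (qvar Phi)))
    (C : clause (qvar Phi)) :
  qres_proof pi C -> forall D, D \in pi -> ~~ tautological D.
Proof.
case=> _ piP; suff all_nt : forall s, prefix s pi -> all (fun D => ~~ tautological D) s.
  exact: (allP (all_nt _ (prefix_refl _))).
elim/last_ind=> [//|s D IHs] /prefixP[s' piE].
rewrite cat_rcons in piE.
have ntS : all (fun D => ~~ tautological D) s by apply/IHs; rewrite piE prefix_prefix.
rewrite all_rcons ntS andbT.
have [/qmatrix_nontaut //|[C1 [C2 [l [_ _ _ _ [_ ->]]]]] //|[C1 C1s ->]] := piP _ _ _ piE.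
apply: contra (allP ntS _ C1s) => /exists_inP[l lC nlC].
by apply/exists_inP; exists l; apply: (subsetP (subsetDl _ _)); eassumption.
Qed.

Lemma satisfies_resolvent (V : finType) (c : V -> bool) (l : lit V)
    (C D : clause V) :
  (exists2 h, h \in C & c h.1 = h.2) -> (exists2 h, h \in D & c h.1 = h.2) ->
  exists2 h, h \in resolvent l C D & c h.1 = h.2.
Proof.
move=> [h hC ch] [g gD cg].
have [hl|hl] := eqVneq h l; last by exists h; rewrite // resolventP hl hC.
exists g; rewrite // resolventP gD andbT orbC.
suff -> : g != neg_lit l by [].
by apply/eqP=> gl; move: cg; rewrite gl -hl /= ch; case: (h.2).
Qed.

(** * Wide clauses from unique universal responses *)

Section Cost.

Variables (V : finType) (k : V -> nat) (phi : {set clause V}).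
Hypothesis k_lt3 : forall x, k x < 3.
Hypothesis k_onto : forall i, i < 3 -> exists x, k x = i.
Hypothesis phi_nontaut : forall C, C \in phi -> ~~ tautological C.

Local Notation Phi := (three_block_qcnf k_lt3 k_onto phi_nontaut).

(* The first clause of the proof without literals of the last block whose first
   block is falsified by [a] must be falsified by the unique winning response
   only, so it mentions every universal variable. *)
Lemma unique_response_clause (a : V -> bool) (pi : seq (clause V)) :
  @qres_proof Phi pi set0 ->
  (forall b : V -> bool, (forall x, k x = 0 -> b x = a x) ->
     (exists2 x, k x = 1 & b x != a x) ->
     exists2 c : V -> bool, forall x, k x != 2 -> c x = b x & satisfies c phi) ->
  exists2 C, C \in pi & ~~ tautological C /\
    forall x, k x = 1 -> (x, ~~ a x) \in C.
Proof.
move=> piP unique.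
pose G (C : clause V) :=
  [forall l in C, (k l.1 != 2) && ((k l.1 == 0) ==> (a l.1 != l.2))].
have hasG : has G pi.
  case: (piP) => -[s ->] _; rewrite has_rcons; apply/orP; left.
  by apply/forall_inP=> l; rewrite inE.
pose C := nth set0 pi (find G pi); pose s1 := take (find G pi) pi.
have lt_find : find G pi < size pi by rewrite -has_find.
have GC : G C by exact: nth_find.
have piE : pi = s1 ++ C :: drop (find G pi).+1 pi.
  by rewrite -(drop_nth set0) // cat_take_drop.
have noG D : D \in s1 -> ~~ G D.
  case/(nthP set0)=> j; rewrite size_take lt_find => lt_j <-.
  by rewrite nth_take // (before_find set0 lt_j).
have Cpi : C \in pi by exact: mem_nth.
have ntC : ~~ tautological C by exact: qres_nontautological piP _ Cpi.
exists C => //; split=> // x0 kx0; apply: contraT => x0C.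
(* [b] falsifies the universal literals of [C] and deviates from [a] wherever [C] leaves a universal
   variable open. As [C] lacks the literal of [x0] that [a] falsifies, [b] differs from [a] at [x0],
   and [unique] supplies a completion [c] satisfying the matrix. *)
pose b y := if k y == 1 then
    if (y, true) \in C then false else if (y, false) \in C then true else ~~ a y
  else a y.
have [x kx||c cb sat_c] := unique b.
- by rewrite /b kx.
- exists x0; rewrite // /b kx0 /=; case: (a x0) x0C => /= /negbTE->.
    by case: ifP.
  by case: ifP.
have satP j s D s' : pi = s ++ D :: s' -> size s < j -> size s <= size s1 ->
    exists2 h, h \in D & c h.1 = h.2.
  elim: j s D s' => // j IHj s D s' sE le_j le_s.
  have sat_s B : B \in s -> exists2 h, h \in B & c h.1 = h.2.
    move=> Bs; have [r [r' rE]] : exists r r', s = r ++ B :: r'.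
      by case/splitPr: Bs => r r'; exists r, r'.
    rewrite rE size_cat /= in le_j le_s.
    apply: (IHj r B (r' ++ D :: s')); [by rewrite sE rE -catA | lia | lia].
  have sub_s B : B \in s -> B \in s1.
    move=> Bs; apply: (@mem_take (size s)).
    rewrite /s1 take_takel; last by move: le_s; rewrite size_take lt_find.
    by rewrite sE take_size_cat.
  have [/sat_c //|[C1 [C2 [l [C1s C2s _ _ [-> _]]]]]|[C1 C1s ->]] := proj2 piP _ _ _ sE.
    by apply: satisfies_resolvent; exact: sat_s.
  (* Reduction could lose the satisfied literal, but a premise before [C] fails [G]: either a
     last-block literal blocks the reduction, or a first-block literal true under [a] survives
     it. *)
  have := noG _ (sub_s _ C1s); rewrite negb_forall => /existsP[l].
  rewrite negb_imply => /andP[lC1]; rewrite negb_and negbK => /orP[/eqP kl|].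
    by rewrite (red3_id lC1 kl); exact: sat_s.
  rewrite negb_imply negbK => /andP[/eqP kl /eqP al].
  exists l; first by rewrite mem_red3 lC1 kl.
  by rewrite cb ?kl // /b kl.
(* [c] satisfies [C], yet by [G] and the choice of [b] every literal of [C] is false under [c]. *)
have [[y e] lC ly] := satP _ _ _ _ piE (ltnSn _) (leqnn _).
have /andP[/= ky] := forall_inP GC _ lC; rewrite cb //= in ly.
rewrite -ly /b; have := k_lt3 y; case kyE: (k y) ky => [|[|[|]]] //= _ _.
  by rewrite eqxx.
move=> _; move: ly; rewrite /b kyE /=; case: e lC => lC; rewrite lC //.
by rewrite (negbTE (nontautologicalP ntC lC)).
Qed.
End Cost.

(** * Trails and proofs checked one element at a time *)

Definition all_steps (E : Type) (Q : seq E -> E -> Prop) (s t : seq E) : Prop :=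
  forall r e r', t = r ++ e :: r' -> Q (s ++ r) e.

Lemma all_steps_nil (E : Type) (Q : seq E -> E -> Prop) s : all_steps Q s [::].
Proof. by case. Qed.

Lemma all_steps_cons (E : Type) (Q : seq E -> E -> Prop) s e t :
  Q s e -> all_steps Q (rcons s e) t -> all_steps Q s (e :: t).
Proof.
move=> Qe Qt [|e1 r] e2 r' [<- tE]; first by rewrite cats0.
by rewrite -cat_rcons; exact: Qt tE.
Qed.

Lemma all_steps_cat (E : Type) (Q : seq E -> E -> Prop) s t1 t2 :
  all_steps Q s t1 -> all_steps Q (s ++ t1) t2 -> all_steps Q s (t1 ++ t2).
Proof.
elim: t1 s => [|e t1 IH] s Q1 Q2; first by rewrite cats0 in Q2.
apply: all_steps_cons.
  by have := Q1 [::] e t1 erefl; rewrite cats0.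
apply: IH; last by rewrite cat_rcons.
by move=> r e' r' tE; rewrite cat_rcons; apply: (Q1 (e :: r) e' r'); rewrite tE.
Qed.

(** The local part of [is_trail]; distinctness of variables and the final position of the conflict
    symbol are left to [is_trail_intro]. *)
Definition trail_step (Phi : qcnf) (psi : {set clause (qvar Phi)})
    (s : trail (qvar Phi)) (e : trail_elt (qvar Phi)) : Prop :=
  match e with
  | Decision d => forall C l, C \in psi -> l \in C ->
      l.1 \notin [seq m.1 | m <- trail_lits s] -> lv d.1 <= lv l.1
  | Propagated x A => unit_at psi s x A
  end.

Lemma is_trail_intro (Phi : qcnf) (psi : {set clause (qvar Phi)})
    (s : trail (qvar Phi)) (e : trail_elt (qvar Phi)) :
  uniq [seq l.1 | l <- trail_lits (rcons s e)] ->
  all (fun e => isSome (elt_lit e)) s ->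
  all_steps (@trail_step Phi psi) [::] (rcons s e) ->
  is_trail psi (rcons s e).
Proof.
move=> uniq_s some_s steps; split=> // r f r' sE.
have := steps _ _ _ sE; case: f sE => [//|x A] sE; split=> // xN.
have [[_ _ ->] //|[r'' sE']] := cat_cons_rcons sE.
by move: some_s; rewrite sE' all_cat xN /= andbF.
Qed.

(** Every element but the last carries its own variable. *)
Lemma size_trail_bound (V : finType) (s : trail V) (e : trail_elt V) :
  uniq [seq l.1 | l <- trail_lits (rcons s e)] ->
  all (fun e => isSome (elt_lit e)) s -> size (rcons s e) <= #|V|.+1.
Proof.
rewrite -cats1 /trail_lits pmap_cat map_cat cat_uniq => /andP[uniq_s _] some_s.
rewrite cats1 size_rcons ltnS.
suff -> : size s = size [seq l.1 | l <- pmap (@elt_lit V) s].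
  by rewrite -(card_uniqP uniq_s) max_card.
by rewrite size_map size_pmap; apply/eqP; rewrite eq_sym -all_count.
Qed.

Definition qcdcl_step (Phi : qcnf)
    (s : seq (trail (qvar Phi) * clause (qvar Phi)))
    (TD : trail (qvar Phi) * clause (qvar Phi)) : Prop :=
  let psi := qmatrix Phi :|: [set B in unzip2 s] in
  [/\ is_trail psi TD.1, has_conflict TD.1, TD.2 \in learnable TD.1,
      s = [::] -> natural_from psi 0 TD.1
    & forall s0 T0 D0, s = rcons s0 (T0, D0) ->
        exists2 k, same_segment k TD.1 T0 & natural_from psi k TD.1].

Lemma all_steps_rcons (E : Type) (Q : seq E -> E -> Prop) s e :
  all_steps Q [::] s -> Q s e -> all_steps Q [::] (rcons s e).
Proof.
move=> Qs Qe; rewrite -cats1; apply: all_steps_cat => //.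
by apply: all_steps_cons => //; exact: all_steps_nil.
Qed.

Lemma trail_lits_rcons (V : finType) (s : trail V) (e : trail_elt V) :
  trail_lits (rcons s e) =
  if elt_lit e is Some l then rcons (trail_lits s) l else trail_lits s.
Proof.
rewrite -cats1 /trail_lits pmap_cat /=.
by case: (elt_lit e) => [l|] /=; rewrite ?cats1 ?cats0.
Qed.

Lemma trail_lits_cat (V : finType) (s t : trail V) :
  trail_lits (s ++ t) = trail_lits s ++ trail_lits t.
Proof. exact: pmap_cat. Qed.

(** * The guarded equality formulas *)

Section GuardedEquality.

Variable n : nat.

Local Notation index := 'I_n.+1.

Definition geq_var : Type := bool * bool * index.
HB.instance Definition _ := Finite.on geq_var.

Local Notation X i := ((false, false, i) : geq_var).
Local Notation A i := ((false, true, i) : geq_var).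
Local Notation U i := ((true, false, i) : geq_var).
Local Notation T i := ((true, true, i) : geq_var).

Definition geq_level (x : geq_var) : nat :=
  if x.1.1 then if x.1.2 then 2 else 1 else 0.

Definition geq_pair (i : index) (b : bool) : clause geq_var :=
  [set (X i, b); (U i, b); (T i, true)].

Definition geq_guard (i : index) : clause geq_var :=
  [set (A i, false); (T i, true)].

Definition geq_unit : clause geq_var := [set (T ord_max, true)].

(* The clause with literals u_n, both signs of u_j for m <= j < n, and the
   negations of t_n and of t_j for j < m. It is an axiom for m = n; for smaller
   m it arises by long-distance resolution. *)
Definition geq_merged (m : nat) : clause geq_var :=
  [set l : geq_var * bool | let: (b1, b2, j, b) := l in
     b1 && (if b2 then ~~ b && ((j < m) || (j == n :> nat))
            else (j == n :> nat) && b || (m <= j < n))].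

(* The result of resolving [geq_merged i.+1] with [geq_pair i c] on t_i. *)
Definition geq_half (i : index) (c : bool) : clause geq_var :=
  [set l : geq_var * bool | let: (b1, b2, j, b) := l in
     if b1 then
       if b2 then ~~ b && ((j < i) || (j == n :> nat))
       else [|| (j == n :> nat) && b, i < j < n | (j == i) && (b == c)]
     else [&& ~~ b2, j == i & b == c]].

Definition geq_matrix : {set clause geq_var} :=
  geq_unit |: (geq_merged n |:
    ([set geq_pair ib.1 ib.2 | ib in [set ib : index * bool | ib.1 < n]] :|:
     [set geq_guard i | i in [set i : index | i < n]])).

Variant geq_axiom : clause geq_var -> Prop :=
  | GeqUnit : geq_axiom geq_unit
  | GeqMerged : geq_axiom (geq_merged n)
  | GeqPair (i : index) b of i < n : geq_axiom (geq_pair i b)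
  | GeqGuard (i : index) of i < n : geq_axiom (geq_guard i).

Lemma geq_matrixP C : C \in geq_matrix <-> geq_axiom C.
Proof.
split.
  case/setU1P=> [->|]; first by constructor.
  case/setU1P=> [->|]; first by constructor.
  case/setUP=> [/imsetP[[i b]]|/imsetP[i]]; rewrite inE /= => lt_in ->.
    exact: GeqPair.
  exact: GeqGuard.
case=> [||i b lt_in|i lt_in]; rewrite /geq_matrix.
- exact: setU11.
- by rewrite in_setU1 setU11 orbT.
- rewrite in_setU1 in_setU1 in_setU; apply/or4P; apply: Or43.
  by apply/imsetP; exists (i, b); rewrite ?inE.
- rewrite in_setU1 in_setU1 in_setU; apply/or4P; apply: Or44.
  by apply/imsetP; exists i; rewrite ?inE.
Qed.

Lemma mem_geq_pair i b l :
  (l \in geq_pair i b) = [|| l == (X i, b), l == (U i, b) | l == (T i, true)].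
Proof. by rewrite !inE orbA. Qed.

Lemma mem_geq_guard i l :
  (l \in geq_guard i) = (l == (A i, false)) || (l == (T i, true)).
Proof. by rewrite !inE. Qed.

Lemma mem_geq_unit l : (l \in geq_unit) = (l == (T ord_max, true)).
Proof. by rewrite inE. Qed.

Lemma geq_nontaut C : C \in geq_matrix -> ~~ tautological C.
Proof.
case/geq_matrixP=> [||i b _|i _].
- by apply: (@nontautological_of _ (fun=> true)) => l; rewrite inE => /eqP->.
- apply: (@nontautological_of _ (fun x : geq_var => ~~ x.1.2)).
  case=> -[[[] []] j] b; rewrite inE //=; first by case: b.
  by rewrite leqNgt andNb orbF => /andP[_ ->].
- apply: (@nontautological_of _ (fun x : geq_var => if x.1.2 then true else b)).
  by move=> l; rewrite mem_geq_pair => /or3P[] /eqP->.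
- apply: (@nontautological_of _ (fun x : geq_var => x.1.1)).
  by move=> l; rewrite mem_geq_guard => /orP[] /eqP->.
Qed.

Lemma geq_level_lt3 x : geq_level x < 3.
Proof. by case: x => [[[] []] i]. Qed.

Lemma geq_level_onto i : i < 3 -> exists x, geq_level x = i.
Proof.
by case: i => [|[|[|]]] // _; [exists (X ord0) | exists (U ord0) | exists (T ord0)].
Qed.

Definition geq_qcnf : qcnf :=
  three_block_qcnf geq_level_lt3 geq_level_onto geq_nontaut.

Local Notation Phi := geq_qcnf.

Lemma card_geq_var : #|{: geq_var}| = 4 * n.+1.
Proof. by rewrite !card_prod !card_bool card_ord. Qed.

Lemma geq_size : qcnf_size Phi <= 2 ^ 6 * n.+1 ^ 2.
Proof.
have cardM : #|qmatrix Phi| <= 3 * n.+1 + 2.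
  have c1 : #|[set geq_pair ib.1 ib.2 | ib in [set ib : index * bool | ib.1 < n]]|
      <= 2 * n.+1.
    apply: leq_trans (leq_imset_card _ _) (leq_trans (max_card _) _).
    by rewrite card_prod card_bool card_ord mulnC.
  have c2 : #|[set geq_guard i | i in [set i : index | i < n]]| <= n.+1.
    apply: leq_trans (leq_imset_card _ _) (leq_trans (max_card _) _).
    by rewrite card_ord.
  have -> : 3 * n.+1 + 2 = 1 + (1 + (2 * n.+1 + n.+1)) by lia.
  apply: leq_trans (leq_card_setU _ _) _; rewrite cards1 leq_add2l.
  apply: leq_trans (leq_card_setU _ _) _; rewrite cards1 leq_add2l.
  by apply: leq_trans (leq_card_setU _ _) _; exact: leq_add.
apply: leq_trans (qcnf_size_bound cardM) _.
rewrite card_geq_var -mulnn (_ : 2 ^ 6 = 64) //; nia.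
Qed.

Lemma geq_false : qcnf_false Phi.
Proof.
apply: three_block_false => a.
(* The universal player copies [x_j] to [u_j] for [j < n] and sets [u_n] to false; this forces every
   [t_j] to be true and falsifies the long clause. *)
exists (fun x : geq_var =>
  if geq_level x == 1 then (x.2 < n) && a (X x.2) else a x).
  by move=> x /negbTE->.
move=> c cP sat_c.
have cX i : c (X i) = a (X i) by rewrite cP.
have cU i : c (U i) = (i < n) && a (X i) by rewrite cP.
have cT i : c (T i) = true.
  have [->|ne_in] := eqVneq i ord_max.
    by have [|l] := sat_c geq_unit; [apply/geq_matrixP; constructor | rewrite inE => /eqP->].
  have lt_in : i < n by rewrite ltn_neqAle -ltnS ltn_ord andbT.
  have [|l] := sat_c (geq_pair i (~~ a (X i))); first by apply/geq_matrixP; constructor.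
  by rewrite mem_geq_pair => /or3P[] /eqP-> //=; rewrite ?cX ?cU ?lt_in //=; case: (a _).
have [|[[[[] []] j] b]] := sat_c (geq_merged n); first by apply/geq_matrixP; constructor.
- by rewrite inE cT /= => /andP[/negbTE->].
- rewrite inE cU /= leqNgt andNb orbF => /andP[/eqP-> ->].
  by rewrite ltnn.
- by rewrite inE.
- by rewrite inE.
Qed.

(** * Exponential lower bound for Q-resolution on guarded equality *)

Definition extend (w : {ffun 'I_n -> bool}) (j : index) : bool :=
  oapp w false (insub (j : nat)).

(** The [x_j] carry [w] and the guards are false; the only winning response repeats [w] and sets
    [u_n] to false, which is the default value of [extend]. *)
Lemma geq_qres_clause (w : {ffun 'I_n -> bool}) (pi : seq (clause geq_var)) :
  @qres_proof Phi pi set0 ->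
  exists2 C, C \in pi & ~~ tautological C /\
    forall j, (U j, ~~ extend w j) \in C.
Proof.
move=> piP.
pose a (x : geq_var) := if x.1.2 then false else extend w x.2.
have wn (j : index) : (j < n) = false -> extend w j = false.
  by move=> ge_jn; rewrite /extend insubF.
have [b bX [[[[] []] j0] //= _ bU]|C Cpi [ntC CP]] :=
  unique_response_clause (a := a) piP; last first.
  by exists C => //; split=> // j; exact: (CP (U j)).
(* After a wrong response at [j0 < n], setting [t_j0] to false satisfies the long clause; for
   [j0 = n] the literal [u_n] does so and all [t_j] stay true. *)
exists (fun x : geq_var =>
  if geq_level x == 2 then (x.2 != j0) || (n <= x.2) else b x).
  by move=> x /negbTE->.
move=> C /geq_matrixP[||i c lt_in|i lt_in].
- by exists (T ord_max, true); rewrite ?inE //= leqnn orbT.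
- have [lt_j|ge_j] := ltnP j0 n.
    by exists (T j0, false); rewrite ?inE /= ?lt_j // eqxx leqNgt lt_j.
  have jn : j0 = n :> nat by apply/eqP; rewrite eqn_leq ge_j -ltnS ltn_ord.
  exists (U j0, true); rewrite ?inE /= ?jn ?eqxx //.
  by move: bU; rewrite /a /= wn; [case: (b _) | rewrite jn ltnn].
- have [ij|ij] := eqVneq i j0; last first.
    by exists (T i, true); rewrite ?mem_geq_pair ?eqxx ?orbT //= ij.
  have [cw|cw] := eqVneq c (extend w i).
    exists (X i, c); rewrite ?mem_geq_pair ?eqxx //=.
    by rewrite bX // /a /= cw.
  exists (U i, c); rewrite ?mem_geq_pair ?eqxx ?orbT //=.
  by move: bU cw; rewrite /a /= -ij; case: (b _) (extend w i) (c) => [] [] [].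
- exists (A i, false); rewrite ?mem_geq_guard ?eqxx //=.
  by rewrite bX.
Qed.

(** Words that differ at [i] demand opposite literals of [u_i], which no nontautological clause
    contains together; hence distinct words yield distinct clauses of [pi]. *)
Lemma geq_qres_hard (pi : seq (clause geq_var)) :
  @qres_proof Phi pi set0 -> 2 ^ n <= size pi.
Proof.
move=> piP.
pose good (w : {ffun 'I_n -> bool}) (C : clause geq_var) :=
  [&& C \in pi, ~~ tautological C & [forall j, (U j, ~~ extend w j) \in C]].
pose f (w : {ffun 'I_n -> bool}) := odflt set0 [pick C | good w C].
have fP w : good w (f w).
  rewrite /f; case: pickP => //= noC.
  have [C Cpi [ntC CP]] := geq_qres_clause w piP.
  by have := noC C; rewrite /good Cpi ntC; move/negP; case; exact/forallP.
have f_inj : injective f.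
  move=> w1 w2 f12; have /and3P[_ nt /forallP w1P] := fP w1.
  have /and3P[_ _ /forallP w2P] := fP w2.
  apply/ffunP=> i; pose j : index := widen_ord (leqnSn n) i.
  have extE w : extend w j = w i by rewrite /extend /= valK.
  move: (w1P j) (w2P j); rewrite -f12 !extE => w1C.
  have := nontautologicalP nt w1C; rewrite /neg_lit /= negbK => w1C'.
  case: (eqVneq (w1 i) (w2 i)) => // ne12 w2C; case/negP: w1C'.
  by have -> : w1 i = ~~ w2 i by case: (w1 i) (w2 i) ne12 => [] [].
have -> : 2 ^ n = #|f @: setT|.
  by rewrite card_imset // cardsT card_ffun card_bool card_ord.
apply: leq_trans (card_size pi); apply: subset_leq_card.
by apply/subsetP=> C /imsetP[w _ ->]; have /and3P[] := fP w.
Qed.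

(** * Segments at which no clause is unit *)

Implicit Types (C D : clause geq_var) (s : trail geq_var) (l p : lit geq_var).

(* The clauses present when stages n-1, ..., i are completed. *)
Variant learned_upto (i : nat) : clause geq_var -> Prop :=
  | LearnedAxiom C of geq_axiom C : learned_upto i C
  | LearnedMerged m of i <= m & m <= n : learned_upto i (geq_merged m)
  | LearnedHalf (j : index) of i <= j & j < n : learned_upto i (geq_half j true).

Lemma merged_T m j b :
  ((T j, b) \in geq_merged m) = ~~ b && ((j < m) || (j == n :> nat)).
Proof. by rewrite inE. Qed.

Lemma merged_U m j b :
  ((U j, b) \in geq_merged m) = (j == n :> nat) && b || (m <= j < n).
Proof. by rewrite inE. Qed.

Lemma half_T i c j b :
  ((T j, b) \in geq_half i c) = ~~ b && ((j < i) || (j == n :> nat)).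
Proof. by rewrite inE. Qed.

Lemma half_U i c j b :
  ((U j, b) \in geq_half i c) =
  [|| (j == n :> nat) && b, i < j < n | (j == i) && (b == c)].
Proof. by rewrite inE. Qed.

(** The state after the guards below [m] have fired: the later guards are not triggered and the
    universal block is untouched. *)
Definition blocked (m : nat) (s : trail geq_var) : Prop :=
  [/\ forall j : index, (j < m) || (j == n :> nat) -> (T j, true) \in trail_lits s,
      forall (j : index) b, (T j, b) \in trail_lits s ->
        b && ((j < m) || (j == n :> nat)),
      forall j b, (U j, b) \notin trail_lits s
    & forall j : index, m <= j -> (A j, true) \notin trail_lits s].

(** As [m < i], the long clause and all learned ones contain [u_n] and the open [-t_m], so [u_n]
    cannot be reduced. Pairs and guards are satisfied for an index below [m]; otherwise they keep
    [t_j] next to an open [u_j] or [-a_j]. *)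
Lemma blocked_not_unit psi s (m : index) i x C :
  m < i -> m < n -> blocked m s -> learned_upto i C ->
  ~ @unit_at Phi psi s x C.
Proof.
move=> lt_mi lt_mn [B1 B2 B3 B4].
have long D : (U ord_max, true) \in D -> (T m, false) \in D ->
    ~ @unit_at Phi psi s x D.
  move=> uD tD; apply: not_unit_of_blocked uD tD _ _ _ _ => //.
    exact: B3.
  by apply/negP=> /(B2 m true); rewrite /= ltnn (ltn_eqF lt_mn).
case=> {}C.
- case=> [||j b lt_jn|j lt_jn].
  + apply: not_unit_of_sat (B1 ord_max _); first by rewrite mem_geq_unit.
    by rewrite eqxx orbT.
  + by apply: long; rewrite ?merged_T ?merged_U /= ?eqxx ?lt_mn.
  + have [lt_jm|ge_jm] := ltnP j m.
      apply: not_unit_of_sat (B1 j _); last by rewrite lt_jm.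
      by rewrite mem_geq_pair eqxx !orbT.
    apply: (@not_unit_of_blocked _ _ _ _ _ _ _ _ _ _ (U j, b) (T j, true)) => //.
    * by rewrite mem_geq_pair eqxx !orbT.
    * by rewrite mem_geq_pair eqxx !orbT.
    * exact: B3.
    * by apply/negP=> /(B2 j false).
  + have [lt_jm|ge_jm] := ltnP j m.
      apply: not_unit_of_sat (B1 j _); last by rewrite lt_jm.
      by rewrite mem_geq_guard eqxx !orbT.
    apply: (@not_unit_of_two _ _ _ _ _ _ _ _ _ _ (A j, false) (T j, true)) => //.
    * by rewrite mem_geq_guard eqxx.
    * by rewrite mem_geq_guard eqxx orbT.
    * exact: B4.
    * by apply/negP=> /(B2 j false).
- move=> le_iC _; apply: long; rewrite ?merged_T ?merged_U /= ?eqxx //.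
  by rewrite (leq_trans lt_mi le_iC).
- move=> le_iC _; apply: long; rewrite ?half_T ?half_U /= ?eqxx //.
  by rewrite (leq_trans lt_mi le_iC).
Qed.

(** Every clause keeps a last-block literal that is not falsified: a positive [t_j], or [-t_m]. *)
Lemma no_conflict psi s (m : index) i C :
  (m < i) && (m < n) || (m == n :> nat) ->
  (forall j, (T j, false) \notin trail_lits s) -> (T m, true) \notin trail_lits s ->
  learned_upto i C -> ~ @unit_at Phi psi s None C.
Proof.
move=> mP N1 N2.
have pos D j : (T j, true) \in D -> ~ @unit_at Phi psi s None D.
  by move=> tD; apply: not_conflict_of_unassigned tD _ _ => //; exact: N1.
have neg D : (T m, false) \in D -> ~ @unit_at Phi psi s None D.
  by move=> tD; apply: not_conflict_of_unassigned tD _ _.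
case=> {}C.
- case=> [||j b _|j _].
  + by apply: (pos _ ord_max); rewrite mem_geq_unit.
  + apply: neg; rewrite merged_T /=.
    by case/orP: mP => [/andP[_ ->]|->]; rewrite ?orbT.
  + by apply: (pos _ j); rewrite mem_geq_pair eqxx !orbT.
  + by apply: (pos _ j); rewrite mem_geq_guard eqxx !orbT.
- move=> le_iC _; apply: neg; rewrite merged_T /=.
  by case/orP: mP => [/andP[lt_mi _]|->]; rewrite ?orbT // (leq_trans lt_mi).
- move=> le_iC _; apply: neg; rewrite half_T /=.
  by case/orP: mP => [/andP[lt_mi _]|->]; rewrite ?orbT // (leq_trans lt_mi).
Qed.

(** * The trails of the QCDCL refutation *)

Fixpoint guarded_prefix (m : nat) : trail geq_var :=
  if m is m'.+1 then
    rcons (rcons (guarded_prefix m') (Decision (A (inord m'), true)))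
      (Propagated (Some (T (inord m'), true)) (geq_guard (inord m')))
  else [:: Propagated (Some (T ord_max, true)) geq_unit].

Lemma mem_guarded_prefix m l :
  m <= n ->
  (l \in trail_lits (guarded_prefix m)) =
  (l == (T ord_max, true)) || [&& l.2, l.1.1.2 & l.1.2 < m].
Proof.
elim: m => [_|m IHm lt_mn] /=.
  by rewrite inE ltn0 !andbF orbF.
rewrite !trail_lits_rcons /= !mem_rcons !inE mem_rcons inE IHm; last exact: ltnW.
case: l {IHm} => [[[b1 b2] j] b]; rewrite !xpair_eqE /=.
have -> : (j == inord m) = (j == m :> nat) by rewrite -val_eqE /= inordK // ltnW.
rewrite [j < m.+1]ltnS [j <= m]leq_eqVlt.
by case: b1 b2 b (_ == m) (j == _) (_ < m) => [] [] [] [] [] [].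
Qed.

Lemma uniq_guarded_prefix m :
  m <= n -> uniq [seq l.1 | l <- trail_lits (guarded_prefix m)].
Proof.
elim: m => [//|m IHm lt_mn] /=.
have notin (b : bool) : ((b, true, inord m) : geq_var) \notin
    [seq l.1 | l <- trail_lits (guarded_prefix m)].
  apply/mapP=> -[l]; rewrite mem_guarded_prefix; last exact: ltnW.
  case: l => [[[b1 b2] j] c] /= + [_ _ jE]; rewrite -{}jE !xpair_eqE /=.
  rewrite inordK; last exact: ltnW.
  rewrite ltnn !andbF orbF -val_eqE /= inordK; last exact: ltnW.
  by rewrite (ltn_eqF lt_mn) !andbF.
rewrite !trail_lits_rcons /= !map_rcons !rcons_uniq mem_rcons inE.
by rewrite !negb_or /= !notin IHm //; exact: ltnW.
Qed.

(** LEV-ORD demands these variables before [u_i]; keeping [x_i] for last lets both trails of a stage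
    share the segment before it. *)
Definition remaining (i : index) : seq geq_var :=
  [seq y : geq_var <- enum {: geq_var} | [&& ~~ y.1.1, ~~ (y.1.2 && (y.2 < i)) & y != X i]].

Definition decide_false (ys : seq geq_var) : trail geq_var :=
  [seq Decision (y, false) | y <- ys].

Lemma trail_lits_decide ys : trail_lits (decide_false ys) = [seq (y, false) | y <- ys].
Proof. by elim: ys => //= y ys IH; rewrite /trail_lits /= -IH. Qed.

Definition stage_prefix (i : index) : trail geq_var :=
  guarded_prefix i ++ decide_false (remaining i).

Lemma mem_stage_prefix (i : index) l :
  i < n ->
  (l \in trail_lits (stage_prefix i)) =
  [|| l == (T ord_max, true), [&& l.2, l.1.1.2 & l.1.2 < i] |
      [&& ~~ l.2, ~~ l.1.1.1, ~~ (l.1.1.2 && (l.1.2 < i)) & l.1 != X i]].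
Proof.
move=> lt_in; rewrite trail_lits_cat mem_cat mem_guarded_prefix; last exact: ltnW.
rewrite trail_lits_decide -orbA; congr [|| _, _ | _].
case: l => y b; apply/mapP/idP => [[z + [-> ->]]|] /=.
  by rewrite mem_filter => /andP[].
case: b => //= yP; exists y => //.
by rewrite mem_filter yP mem_enum.
Qed.

Lemma blocked_guarded_prefix m : m < n -> blocked m (guarded_prefix m).
Proof.
move=> lt_mn; have mE := fun l => mem_guarded_prefix l (ltnW lt_mn).
split=> [j jP|j b|j b|j le_mj]; rewrite mE !xpair_eqE /= -?val_eqE /=.
- by rewrite andbT orbC.
- by case: b; rewrite ?andbT ?andbF //= orbC.
- by rewrite andbF.
- by rewrite ltnNge le_mj.
Qed.

Lemma blocked_cat m s t :
  blocked m s ->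
  (forall l, l \in trail_lits t ->
     ~~ l.1.1.1 && (l.2 ==> ~~ l.1.1.2)) -> blocked m (s ++ t).
Proof.
move=> [B1 B2 B3 B4] tP; split=> [j jP|j b|j b|j le_mj];
  rewrite trail_lits_cat mem_cat.
- by rewrite B1.
- by case/orP=> [/B2 //|/tP].
- by rewrite negb_or B3; apply/negP=> /tP.
- by rewrite negb_or B4 //; apply/negP=> /tP.
Qed.

Lemma blocked_decide (i : index) ys :
  i < n -> all (fun y : geq_var => ~~ y.1.1) ys ->
  blocked i (guarded_prefix i ++ decide_false ys).
Proof.
move=> lt_in ysP; apply: blocked_cat (blocked_guarded_prefix lt_in) _ => l.
by rewrite trail_lits_decide => /mapP[y /(allP ysP) yX ->]; rewrite /= yX.
Qed.

Lemma natural_no_unit (psi : {set clause geq_var}) s e :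
  (forall x C, C \in psi -> ~ @unit_at Phi psi s x C) -> @natural_at Phi psi s e.
Proof. by move=> nounit [x [C unitC]]; case: (nounit x C (proj1 unitC)). Qed.

Lemma natural_no_conflict (psi : {set clause geq_var}) s p C :
  @unit_at Phi psi s (Some p) C ->
  (forall D, D \in psi -> ~ @unit_at Phi psi s None D) ->
  @natural_at Phi psi s (Propagated (Some p) C).
Proof.
move=> unitC noconf _; exists (Some p), C; split=> // -[D unitD].
by case: (noconf D (proj1 unitD)).
Qed.

Lemma decision_step psi s l :
  geq_level l.1 = 0 -> @trail_step Phi psi s (Decision l).
Proof. by move=> kl C m _ _ _; rewrite !lv3E kl. Qed.

Lemma blocked_rcons m s e l :
  blocked m s -> elt_lit e = Some l -> ~~ l.1.1.1 && (l.2 ==> ~~ l.1.1.2) ->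
  blocked m (rcons s e).
Proof.
move=> sB eE lP; rewrite -cats1; apply: blocked_cat => // h.
by rewrite /trail_lits /= eE inE => /eqP->.
Qed.

(** With [x_i] and [u_i] both set to [c], the pair clause of opposite sign forces [t_i]. Then all
    last-block literals of [geq_merged i.+1] are false and its universal literals reduce. *)
Definition stage_tail (i : index) (c : bool) : trail geq_var :=
  [:: Decision (U i, c); Propagated (Some (T i, true)) (geq_pair i (~~ c));
      Propagated None (geq_merged i.+1)].

Section Stage.

Variables (psi : {set clause geq_var}).
Hypothesis psi_axioms : forall C, geq_axiom C -> C \in psi.

Lemma unit_step s : trail_lits s = [::] ->
  @unit_at Phi psi s (Some (T ord_max, true)) geq_unit.
Proof.
move=> s0; apply: unit_intro; rewrite ?s0 ?mem_geq_unit //.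
- by apply: psi_axioms; constructor.
- by move=> l; rewrite mem_geq_unit => /eqP->; rewrite eqxx.
Qed.

Lemma guard_step m :
  m < n ->
  @unit_at Phi psi (rcons (guarded_prefix m) (Decision (A (inord m), true)))
    (Some (T (inord m), true)) (geq_guard (inord m)).
Proof.
move=> lt_mn; have mE : (inord m : index) = m :> nat by rewrite inordK // ltnW.
have memE l : (l \in trail_lits (rcons (guarded_prefix m) (Decision (A (inord m), true))))
    = [|| l == (A (inord m), true), l == (T ord_max, true) |
          [&& l.2, l.1.1.2 & l.1.2 < m]].
  by rewrite trail_lits_rcons mem_rcons inE mem_guarded_prefix // ltnW.
apply: unit_intro => //.
- by apply: psi_axioms; apply: GeqGuard; rewrite mE.
- by rewrite mem_geq_guard eqxx orbT.
- move=> l; rewrite mem_geq_guard memE => /orP[] /eqP-> //=.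
    by rewrite !xpair_eqE /= andbF.
  by rewrite !xpair_eqE /= -val_eqE /= mE ltnn orbF (ltn_eqF lt_mn).
- by rewrite memE /neg_lit /= !xpair_eqE !andbF.
- move=> l; rewrite mem_geq_guard => /orP[] /eqP-> //; last by rewrite eqxx.
  by left; rewrite memE eqxx.
Qed.

Lemma guarded_prefix_steps m :
  m <= n -> all_steps (@trail_step Phi psi) [::] (guarded_prefix m).
Proof.
elim: m => [_|m IHm lt_mn] /=.
  by apply: all_steps_cons; [exact: unit_step | exact: all_steps_nil].
apply: all_steps_rcons; last exact: guard_step.
by apply: all_steps_rcons; [exact/IHm/ltnW | exact: decision_step].
Qed.

Lemma decide_steps s ys :
  all (fun y : geq_var => ~~ y.1.1) ys ->
  all_steps (@trail_step Phi psi) s (decide_false ys).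
Proof.
elim: ys s => [|y ys IH] s /=; first by move=> _; exact: all_steps_nil.
case/andP=> yX ysX; apply: all_steps_cons; last exact: IH.
by apply: decision_step; rewrite /geq_level (negbTE yX).
Qed.

Lemma remainingX i : all (fun y : geq_var => ~~ y.1.1) (remaining i).
Proof. by apply/allP=> y; rewrite mem_filter => /andP[/and3P[]]. Qed.

Lemma stage_prefix_steps (i : index) :
  i < n -> all_steps (@trail_step Phi psi) [::] (stage_prefix i).
Proof.
move=> lt_in; apply: all_steps_cat; first exact/guarded_prefix_steps/ltnW.
exact/decide_steps/remainingX.
Qed.

Lemma root_natural i :
  (forall C, C \in psi -> learned_upto i C) ->
  @natural_at Phi psi [::] (Propagated (Some (T ord_max, true)) geq_unit).
Proof.
move=> psiP; apply: natural_no_conflict; first exact: unit_step.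
by move=> D /psiP; apply: (@no_conflict _ _ ord_max i); rewrite // eqxx orbT.
Qed.

(** A guard is decided only at a blocked segment, where nothing is unit; its guard clause may
    propagate right afterwards because no clause is conflicting. *)
Lemma guarded_prefix_natural i m :
  (forall C, C \in psi -> learned_upto i C) -> m < i -> i <= n ->
  all_steps (@natural_at Phi psi) [::] (guarded_prefix m).
Proof.
move=> psiP; elim: m => [_ _|m IHm lt_mi le_in] /=.
  by apply: all_steps_cons; [exact: root_natural psiP | exact: all_steps_nil].
have lt_mn : m < n by exact: ltn_trans (ltnSn m) (leq_trans lt_mi le_in).
have mE : (inord m : index) = m :> nat by rewrite inordK // ltnW.
have [_ B2 _ _] := blocked_guarded_prefix lt_mn.
apply: all_steps_rcons.
  apply: all_steps_rcons; first by apply: IHm => //; exact: ltnW.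
  apply: natural_no_unit => x C /psiP; apply: (@blocked_not_unit _ _ (inord m)).
  - by rewrite mE ltnW.
  - by rewrite mE.
  - by rewrite mE; exact: blocked_guarded_prefix.
apply: natural_no_conflict; first exact: guard_step.
move=> D /psiP; apply: (@no_conflict _ _ (inord m)).
- by rewrite mE lt_mn (ltnW lt_mi).
- by move=> j; rewrite trail_lits_rcons mem_rcons inE negb_or; apply/negP=> /B2.
- rewrite trail_lits_rcons mem_rcons inE negb_or; apply/negP=> /B2.
  by rewrite mE ltnn (ltn_eqF lt_mn).
Qed.

Lemma stage_prefix_natural (i : index) :
  (forall C, C \in psi -> learned_upto i.+1 C) -> i < n ->
  all_steps (@natural_at Phi psi) [::] (stage_prefix i).
Proof.
move=> psiP lt_in; apply: all_steps_cat.
  exact: guarded_prefix_natural psiP _ _.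
move=> r e r' rE; apply: natural_no_unit => x C /psiP.
apply: blocked_not_unit => //.
have -> : r = decide_false (take (size r) (remaining i)).
  by rewrite /decide_false map_take -/(decide_false _) rE take_size_cat.
apply: blocked_decide => //; apply/allP=> y /mem_take.
exact: (allP (remainingX i)).
Qed.


Section StageTail.

Variables (i : index) (c : bool) (e : trail_elt geq_var).
Hypotheses (lt_in : i < n) (eE : elt_lit e = Some (X i, c)).

(** Only the literal of [e] is fixed, so the trail that decides [x_i] and the one that propagates it
    are treated together. *)
Let stem := rcons (stage_prefix i) e.

Lemma blocked_stem : blocked i stem.
Proof.
apply: (blocked_rcons _ eE); last by rewrite implybT.
exact/blocked_decide/remainingX.
Qed.

Lemma stem_lits : trail_lits stem = rcons (trail_lits (stage_prefix i)) (X i, c).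
Proof. by rewrite trail_lits_rcons eE. Qed.

Lemma stem_X : (X i, c) \in trail_lits stem /\ (X i, ~~ c) \notin trail_lits stem.
Proof.
rewrite stem_lits; split; first by rewrite mem_rcons mem_head.
rewrite mem_rcons in_cons mem_stage_prefix // negb_or; apply/andP; split.
  by rewrite xpair_eqE eqxx; case: (c).
by rewrite /= eqxx !andbF.
Qed.

(** This is what LEV-ORD requires before the decision of [u_i]. *)
Lemma stem_covers x : ~~ x.1.1 -> x \in [seq l.1 | l <- trail_lits stem].
Proof.
move=> xX; rewrite stem_lits map_rcons mem_rcons inE.
have [//|ne_x] := eqVneq x (X i); rewrite /=.
have [xA|xA] := boolP (x.1.2 && (x.2 < i)); apply/mapP.
  by exists (x, true); rewrite // mem_stage_prefix //= xA orbT.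
by exists (x, false); rewrite // mem_stage_prefix //= xX xA ne_x !orbT.
Qed.

Lemma tail_unit :
  @unit_at Phi psi (rcons stem (Decision (U i, c))) (Some (T i, true))
    (geq_pair i (~~ c)).
Proof.
have [B1 B2 B3 B4] := blocked_stem; have [XS nXS] := stem_X.
have memE l : (l \in trail_lits (rcons stem (Decision (U i, c)))) =
    (l == (U i, c)) || (l \in trail_lits stem).
  by rewrite trail_lits_rcons mem_rcons inE.
have nT b : (T i, b) \notin trail_lits stem.
  by apply/negP=> /B2; rewrite ltnn (ltn_eqF lt_in) andbF.
apply: unit_intro => //.
- by apply: psi_axioms; constructor.
- by rewrite mem_geq_pair eqxx !orbT.
- move=> l; rewrite mem_geq_pair memE => /or3P[] /eqP->; rewrite negb_or.
  + by rewrite nXS.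
  + by rewrite B3 !xpair_eqE !eqxx; case: (c).
  + by rewrite nT.
- by rewrite memE negb_or nT.
- move=> l; rewrite mem_geq_pair memE => /or3P[] /eqP-> ne; [left | left |].
  + by rewrite /neg_lit /= negbK XS.
  + by rewrite /neg_lit /= negbK eqxx.
  + by rewrite eqxx in ne.
Qed.

Lemma tail_conflict :
  geq_merged i.+1 \in psi ->
  @unit_at Phi psi
    (rcons (rcons stem (Decision (U i, c)))
       (Propagated (Some (T i, true)) (geq_pair i (~~ c))))
    None (geq_merged i.+1).
Proof.
have [B1 B2 B3 B4] := blocked_stem.
move=> psiD; have memE l : (l \in trail_lits (rcons (rcons stem (Decision (U i, c)))
       (Propagated (Some (T i, true)) (geq_pair i (~~ c))))) =
    [|| l == (T i, true), l == (U i, c) | l \in trail_lits stem].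
  by rewrite !trail_lits_rcons !mem_rcons !inE mem_rcons inE.
apply: conflict_intro => // -[[[[] []] j] b]; rewrite ?merged_T ?merged_U memE.
- case/andP=> /negbTE-> _; rewrite !negb_or !xpair_eqE !andbF /=.
  by apply/negP=> /B2.
(* The clause may contain both signs of a universal variable, so no variable of it may be decided;
   the only one decided is [u_i], which it does not mention. *)
- rewrite !negb_or (negbTE (B3 j b)) andbT !xpair_eqE /=.
  case/orP=> [/andP[/eqP jn _]|/andP[lt_ij _]]; rewrite negb_and; apply/orP; left.
    by apply/eqP=> ji; move: lt_in; rewrite -ji jn ltnn.
  by apply/eqP=> ji; move: lt_ij; rewrite ji ltnn.
- by rewrite inE.
- by rewrite inE.
- case/andP=> /negbTE-> jP; left; rewrite /neg_lit /= !xpair_eqE /= andbT.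
  have [//|ne_ji] := eqVneq j i; rewrite /= B1 ?orbT //.
  by case/orP: jP => [|->]; rewrite ?orbT // ltnS leq_eqVlt val_eqE (negbTE ne_ji) /= => ->.
- by right.
- by rewrite inE.
- by rewrite inE.
Qed.

Lemma tail_steps :
  geq_merged i.+1 \in psi -> all_steps (@trail_step Phi psi) stem (stage_tail i c).
Proof.
move=> psiD; apply: all_steps_cons; last apply: all_steps_cons; last apply: all_steps_cons.
- move=> C l _ _; rewrite !lv3E; case: l => -[[[] b2] j] b /=; last by rewrite stem_covers.
  by case: b2.
- exact: tail_unit.
- exact: tail_conflict.
- exact: all_steps_nil.
Qed.

(** In the second trail of a stage [geq_half i true] is already present, but [x_i] is true there and
    satisfies it. *)
Lemma tail_natural :
  (forall C, C \in psi ->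
     learned_upto i.+1 C \/ C = geq_half i true /\ c = true) ->
  geq_merged i.+1 \in psi ->
  all_steps (@natural_at Phi psi) stem (stage_tail i c).
Proof.
move=> psiP psiD; have [B1 B2 B3 B4] := blocked_stem; have [XS _] := stem_X.
have halfX : (X i, true) \in geq_half i true by rewrite inE /= !eqxx.
apply: all_steps_cons; last apply: all_steps_cons; last apply: all_steps_cons.
- apply: natural_no_unit => x C /psiP[upC|[-> cT]].
    by apply: blocked_not_unit upC => //; exact: blocked_stem.
  by apply: not_unit_of_sat halfX _; rewrite cT in XS.
- apply: natural_no_conflict; first exact: tail_unit.
  move=> C /psiP[upC|[-> cT]].
    apply: (@no_conflict _ _ i i.+1) upC; first by rewrite ltnSn lt_in.
      move=> j; rewrite trail_lits_rcons mem_rcons inE negb_or /=.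
      by apply/negP=> /B2.
    rewrite trail_lits_rcons mem_rcons inE negb_or /=.
    by apply/negP=> /B2; rewrite ltnn (ltn_eqF lt_in).
  apply: not_unit_of_sat halfX _.
  by rewrite trail_lits_rcons mem_rcons inE -cT XS orbT.
- by move=> _; exists None, (geq_merged i.+1); split=> //; exact: tail_conflict.
- exact: all_steps_nil.
Qed.

End StageTail.

End Stage.

Lemma uniq_stage_trail (i : index) c e :
  i < n -> elt_lit e = Some (X i, c) ->
  uniq [seq l.1 | l <- trail_lits (rcons (stage_prefix i) e ++ stage_tail i c)].
Proof.
move=> lt_in eE.
rewrite trail_lits_cat map_cat cat_uniq; apply/and3P; split=> //.
  rewrite (stem_lits eE) map_rcons rcons_uniq; apply/andP; split.
    apply/mapP=> -[[x b]]; rewrite mem_stage_prefix //= => + xE.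
    by rewrite -xE eqxx !andbF xpair_eqE.
  rewrite /stage_prefix trail_lits_cat trail_lits_decide map_cat cat_uniq.
  rewrite uniq_guarded_prefix; last exact: ltnW.
  rewrite -map_comp map_id filter_uniq ?enum_uniq // andbT.
  apply/hasPn=> x; rewrite mem_filter => /andP[/and3P[xX xA _] _].
  apply/mapP=> -[[y b]]; rewrite mem_guarded_prefix; last exact: ltnW.
  move=> + /= yx; rewrite -yx => /orP[|/andP[_ xA']].
    by rewrite xpair_eqE => /andP[/eqP xT _]; rewrite xT in xX.
  by rewrite xA' in xA.
have [_ B2 B3 _] := blocked_stem lt_in eE.
apply/hasPn=> x; rewrite /= !inE => /orP[] /eqP->; apply/mapP=> -[[y b] + /= yE];
  rewrite -yE.
  by apply/negP; exact: B3.
by move/B2; rewrite ltnn (ltn_eqF lt_in) andbF.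
Qed.

(** * The clauses learned from these trails *)

Lemma learn_merged (i : index) b :
  i < n ->
  @learn_step Phi (geq_merged i.+1) ((T i, true), geq_pair i b) = geq_half i b.
Proof.
move=> lt_in; rewrite /learn_step merged_T ltnSn /=.
(* [-t_n] stays in every clause learned before the last trail and keeps reduction from removing the
   universal literals. *)
have halfT : (T ord_max, false) \in geq_half i b by rewrite half_T /= eqxx orbT.
rewrite (red3_id (C := geq_pair i b) (t := (T i, true))) ?mem_geq_pair ?eqxx ?orbT //.
apply: etrans (red3_id halfT erefl); congr red.
apply/setP=> -[[[[] []] j] d]; rewrite resolventP mem_geq_pair.
- rewrite merged_T half_T /neg_lit !xpair_eqE /=.
  case: d; rewrite /= ?andbT ?andbF ?orbF ?andNb //.
  have [->|ne_ji] := eqVneq j i; first by rewrite ltnn (ltn_eqF lt_in).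
  by rewrite /= ltnS leq_eqVlt val_eqE (negbTE ne_ji).
- by rewrite merged_U half_U /neg_lit !xpair_eqE /= orbF orbC orbA.
- by rewrite !inE !xpair_eqE /= ?andbF.
- by rewrite !inE !xpair_eqE /= ?orbF.
Qed.

(** The two halves differ only in the signs of [x_i] and [u_i]. Resolving on [x_i] merges [u_i] and
    [-u_i] into a tautological clause, which learning accepts and Q-resolution forbids. *)
Lemma learn_half (i : index) :
  i < n ->
  @learn_step Phi (geq_half i false) ((X i, true), geq_half i true) = geq_merged i.
Proof.
move=> lt_in; have halfX : (X i, false) \in geq_half i false by rewrite inE /= eqxx.
have halfT b : (T ord_max, false) \in geq_half i b by rewrite half_T /= eqxx orbT.
rewrite /learn_step halfX (red3_id (halfT true) erefl).
have mergedT : (T ord_max, false) \in geq_merged i by rewrite merged_T /= eqxx orbT.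
apply: etrans (red3_id mergedT erefl); congr red.
apply/setP=> -[[[[] []] j] d]; rewrite resolventP.
- by rewrite merged_T !half_T /neg_lit !xpair_eqE /= orbb.
- rewrite merged_U !half_U /neg_lit !xpair_eqE /=.
  have [->|ne_ji] := eqVneq j i; last first.
    by rewrite /= !orbF orbb [i <= j]leq_eqVlt val_eqE [i == j]eq_sym (negbTE ne_ji).
  by rewrite leqnn lt_in ltnn (ltn_eqF lt_in); case: d.
- by rewrite !inE /= ?andbF.
- rewrite !inE !xpair_eqE /=.
  by case: d; rewrite /= ?andbF ?andbT ?orbF ?andNb.
Qed.

(** Once [t_n] is resolved away no last-block literal is left, so reduction removes all universal
    literals, complementary pairs included. *)
Lemma learn_root :
  @learn_step Phi (geq_merged 0) ((T ord_max, true), geq_unit) = set0.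
Proof.
rewrite /learn_step merged_T eqxx orbT /=.
rewrite (red3_id (C := geq_unit) (t := (T ord_max, true))) ?mem_geq_unit //.
have noT j d : (T j, d) \notin resolvent (T ord_max, true) geq_unit (geq_merged 0).
  rewrite resolventP mem_geq_unit andNb merged_T ltn0 /=.
  case: d; rewrite /= ?andbF //; apply/negP=> /andP[+ /eqP jn].
  by rewrite /neg_lit xpair_eqE /= andbT xpair_eqE /= -val_eqE /= jn eqxx.
apply/setP=> l; rewrite mem_red3 in_set0; apply/negP=> /andP[lR /orP[kl|]].
  case: l kl lR => -[[[] []] j] d //= _; first by rewrite (negbTE (noT j d)).
    by rewrite !inE !xpair_eqE /= ?andbF.
  by rewrite !inE !xpair_eqE /= ?andbF.
by case/exists_inP=> -[[[[] []] j] d] //; rewrite (negbTE (noT j d)).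
Qed.

Local Arguments learn_step : simpl never.

(** Learning is made explicit only up to the element [e]; [L] collects what follows. *)
Lemma stage_learnable (i : index) c e :
  i < n ->
  exists L, @learnable Phi (rcons (stage_prefix i) e ++ stage_tail i c) =
    geq_merged i.+1 :: geq_half i (~~ c) ::
      (if elt_propagation e is Some pA then [:: @learn_step Phi (geq_half i (~~ c)) pA]
       else [::]) ++ L.
Proof.
move=> lt_in; rewrite /learnable rev_cat rev_rcons.
rewrite (_ : rev (stage_tail i c) = [:: Propagated None (geq_merged i.+1);
  Propagated (Some (T i, true)) (geq_pair i (~~ c)); Decision (U i, c)]) //=.
rewrite (red3_id (C := geq_merged i.+1) (t := (T ord_max, false))) ?merged_T //= ?eqxx ?orbT //.
rewrite learn_merged //.
case: (elt_propagation e) => [pA|] /=; eexists; reflexivity.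
Qed.

Lemma natural_from_cat (psi : {set clause geq_var}) s t :
  all_steps (@natural_at Phi psi) s t -> @natural_from Phi psi (size s) (s ++ t).
Proof.
move=> natP r e r' rE le_sr.
have sE : s = take (size s) r.
  by rewrite -(takel_cat (e :: r') le_sr) -rE take_size_cat.
have drE : r = s ++ drop (size s) r by rewrite {1}sE cat_take_drop.
have tE : t = drop (size s) r ++ e :: r'.
  by rewrite -(drop_size_cat t (erefl (size s))) rE {1}drE -catA drop_size_cat.
by rewrite drE; exact: natP tE.
Qed.

(** The last-block literals of the half clause are all falsified by the guarded prefix, so its open
    universal literals reduce and only [x_i] is left. *)
Lemma half_unit (psi : {set clause geq_var}) (i : index) :
  i < n -> geq_half i true \in psi ->
  @unit_at Phi psi (stage_prefix i) (Some (X i, true)) (geq_half i true).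
Proof.
move=> lt_in psiH; have [B1 B2 B3 B4] := blocked_decide lt_in (remainingX i).
have nX b : (X i, b) \notin trail_lits (stage_prefix i).
  by rewrite mem_stage_prefix //= eqxx !andbF.
apply: unit_intro => //; first by rewrite inE /= eqxx.
- case=> -[[[] []] j] b.
  + by rewrite half_T => /andP[/negbTE-> _]; apply/negP=> /B2.
  + by move=> _; exact: B3.
  + by rewrite inE.
  + by rewrite inE /= => /andP[/eqP-> /eqP->].
- exact: nX.
- case=> -[[[] []] j] b.
  + by rewrite half_T => /andP[/negbTE-> jP] _; left; exact: B1.
  + by move=> _ _; right.
  + by rewrite inE.
  + by rewrite inE /= => /andP[/eqP-> /eqP->]; rewrite eqxx.
Qed.

Lemma all_some_stage (i : index) e :
  isSome (elt_lit e) ->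
  all (fun e => isSome (elt_lit e)) (rcons (stage_prefix i) e).
Proof.
move=> eS; rewrite all_rcons eS /= all_cat all_map; apply/andP; split.
  by elim: (nat_of_ord i) => //= m IHm; rewrite !all_rcons.
by elim: (remaining i).
Qed.

Lemma stage_trail_rcons (i : index) c e :
  rcons (stage_prefix i) e ++ stage_tail i c =
  rcons (rcons (stage_prefix i) e ++
    [:: Decision (U i, c); Propagated (Some (T i, true)) (geq_pair i (~~ c))])
    (Propagated None (geq_merged i.+1)).
Proof. by rewrite rcons_cat. Qed.

Lemma all_some_stage_trail (i : index) c e :
  isSome (elt_lit e) ->
  all (fun e => isSome (elt_lit e)) (rcons (stage_prefix i) e ++
    [:: Decision (U i, c); Propagated (Some (T i, true)) (geq_pair i (~~ c))]).
Proof. by move=> eS; rewrite all_cat all_some_stage. Qed.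

Lemma stage_is_trail (psi : {set clause geq_var}) (i : index) c e :
  (forall C, geq_axiom C -> C \in psi) -> geq_merged i.+1 \in psi -> i < n ->
  elt_lit e = Some (X i, c) -> @trail_step Phi psi (stage_prefix i) e ->
  @is_trail Phi psi (rcons (stage_prefix i) e ++ stage_tail i c).
Proof.
move=> psiA psiD lt_in eE eP; have := uniq_stage_trail lt_in eE.
rewrite stage_trail_rcons => uniqT; apply: is_trail_intro => //.
  by apply: all_some_stage_trail; rewrite eE.
rewrite -stage_trail_rcons; apply: all_steps_cat; last exact: tail_steps.
by apply: all_steps_rcons => //; exact: stage_prefix_steps.
Qed.

Lemma size_stage_trail (i : index) c e :
  i < n -> elt_lit e = Some (X i, c) ->
  size (rcons (stage_prefix i) e ++ stage_tail i c) <= #|{: geq_var}|.+1.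
Proof.
move=> lt_in eE; have := uniq_stage_trail lt_in eE.
rewrite stage_trail_rcons => uniqT; apply: size_trail_bound => //.
by apply: all_some_stage_trail; rewrite eE.
Qed.

Lemma stage_has_conflict (i : index) c e :
  has_conflict (rcons (stage_prefix i) e ++ stage_tail i c).
Proof. by rewrite stage_trail_rcons; eexists; eexists. Qed.

(** * Assembling the QCDCL refutation *)

Local Notation clauses_of iota := (geq_matrix :|: [set B in unzip2 iota]).

(** First trail of a stage: it yields [geq_half i true]. The second one, [stage_propagated], goes
    back to before the decision of [x_i], where this clause now propagates [x_i], and yields
    [geq_merged i]. *)
Definition stage_decided (i : index) : trail geq_var :=
  rcons (stage_prefix i) (Decision (X i, false)) ++ stage_tail i false.

Definition stage_propagated (i : index) : trail geq_var :=
  rcons (stage_prefix i) (Propagated (Some (X i, true)) (geq_half i true)) ++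
  stage_tail i true.

Lemma same_segment0 (V : finType) (t1 t2 : trail V) : same_segment 0 t1 t2.
Proof. by split; rewrite ?take0. Qed.

Lemma stage_decided_step iota (i : index) :
  i < n -> (forall C, C \in clauses_of iota -> learned_upto i.+1 C) ->
  geq_merged i.+1 \in clauses_of iota ->
  @qcdcl_step Phi iota (stage_decided i, geq_half i true).
Proof.
move=> lt_in psiP psiD.
have psiA C : geq_axiom C -> C \in clauses_of iota.
  by move=> /geq_matrixP CM; apply/setUP; left.
have natT : @natural_from Phi (clauses_of iota) 0 (stage_decided i).
  suff natP : all_steps (@natural_at Phi (clauses_of iota)) [::] (stage_decided i).
    by move=> s e s' sE _; exact: natP sE.
  apply: all_steps_cat; last first.
    by apply: tail_natural => // C /psiP; left.
  apply: all_steps_rcons; first exact: stage_prefix_natural.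
  apply: natural_no_unit => x C /psiP; apply: blocked_not_unit => //.
  exact: blocked_decide (remainingX i).
split=> //.
- by apply: stage_is_trail => //; exact: decision_step.
- exact: stage_has_conflict.
- have [L ->] := stage_learnable false (Decision (X i, false)) lt_in.
  by rewrite !inE eqxx orbT.
(* The trail is natural from the root, so it counts as a restart at the empty segment. *)
- by move=> s0 T0 D0 _; exists 0 => //; exact: same_segment0.
Qed.

Lemma stage_propagated_step iota (i : index) :
  i < n -> (forall C, C \in clauses_of iota -> learned_upto i.+1 C) ->
  geq_merged i.+1 \in clauses_of iota ->
  @qcdcl_step Phi (rcons iota (stage_decided i, geq_half i true))
    (stage_propagated i, geq_merged i).
Proof.
move=> lt_in psiP psiD; pose iota' := rcons iota (stage_decided i, geq_half i true).
have psiE C : C \in clauses_of iota' = (C \in clauses_of iota) || (C == geq_half i true).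
  rewrite 2!(in_setU _ geq_matrix) -orbA; congr (_ || _).
  by rewrite !inE /iota' /unzip2 map_rcons mem_rcons in_cons orbC.
have psiA C : geq_axiom C -> C \in clauses_of iota'.
  by move=> /geq_matrixP CM; apply/setUP; left.
have psiD' : geq_merged i.+1 \in clauses_of iota' by rewrite psiE psiD.
have psiH : geq_half i true \in clauses_of iota' by rewrite psiE eqxx orbT.
have [B1 B2 B3 B4] := blocked_decide lt_in (remainingX i).
split=> //=.
- by apply: stage_is_trail => //; exact: half_unit.
- exact: stage_has_conflict.
- have [L ->] := stage_learnable true
    (Propagated (Some (X i, true)) (geq_half i true)) lt_in.
  by rewrite /= learn_half // !inE eqxx !orbT.
- by move/(congr1 size); rewrite size_rcons.
(* Backtracking stops just before [x_i], at the segment shared by both trails of the stage. *)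
move=> s0 T0 D0 /rcons_inj[_ <- _]; exists (size (stage_prefix i)).
  rewrite /stage_propagated /stage_decided !cat_rcons; split.
  - by rewrite [leqRHS]size_cat leq_addr.
  - by rewrite [leqRHS]size_cat leq_addr.
  - by rewrite !take_size_cat.
rewrite /stage_propagated cat_rcons; apply: natural_from_cat.
apply: all_steps_cons.
  apply: natural_no_conflict; first exact: half_unit.
  move=> C; rewrite psiE => /orP[/psiP upC|/eqP->].
    apply: (@no_conflict _ _ i i.+1) upC; first by rewrite ltnSn lt_in.
      by move=> j; apply/negP=> /B2.
    by apply/negP=> /B2; rewrite ltnn (ltn_eqF lt_in).
  apply: (@not_conflict_of_unassigned _ _ _ _ _ _ _ _ _ (X i, true)) => //.
    by rewrite inE /= eqxx.
  by rewrite mem_stage_prefix // /neg_lit /= eqxx ?andbF.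
apply: tail_natural => // C; rewrite psiE => /orP[/psiP|/eqP->]; first by left.
by right.
Qed.

Lemma final_step iota :
  (forall C, C \in clauses_of iota -> learned_upto 0 C) ->
  geq_merged 0 \in clauses_of iota ->
  @qcdcl_step Phi iota
    ([:: Propagated (Some (T ord_max, true)) geq_unit;
         Propagated None (geq_merged 0)], set0).
Proof.
move=> psiP psiD.
have psiA C : geq_axiom C -> C \in clauses_of iota.
  by move=> /geq_matrixP CM; apply/setUP; left.
have conf : @unit_at Phi (clauses_of iota)
    [:: Propagated (Some (T ord_max, true)) geq_unit] None (geq_merged 0).
  apply: conflict_intro => // -[[[[] []] j] b]; rewrite /trail_lits /= !inE //=.
  - by case/andP=> /negbTE-> _; rewrite xpair_eqE andbF.
  - case/andP=> /negbTE-> /eqP jn; left.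
    by rewrite /neg_lit /= !xpair_eqE /= -val_eqE /= jn eqxx.
  - by right.
have natT : @natural_from Phi (clauses_of iota) 0
    [:: Propagated (Some (T ord_max, true)) geq_unit; Propagated None (geq_merged 0)].
  suff natP : all_steps (@natural_at Phi (clauses_of iota)) [::]
      [:: Propagated (Some (T ord_max, true)) geq_unit; Propagated None (geq_merged 0)].
    by move=> s e s' sE _; exact: natP sE.
  apply: all_steps_cons; first exact: root_natural psiP.
  apply: all_steps_cons; last exact: all_steps_nil.
  by move=> _; exists None, (geq_merged 0).
split=> //.
- apply: (@is_trail_intro Phi (clauses_of iota)
    [:: Propagated (Some (T ord_max, true)) geq_unit]
    (Propagated None (geq_merged 0))) => //.
  apply: all_steps_cons; first exact: unit_step.
  by apply: all_steps_cons; last exact: all_steps_nil.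
- by exists [:: Propagated (Some (T ord_max, true)) geq_unit], (geq_merged 0).
- rewrite /learnable /= /rev /=.
  rewrite (red3_id (C := geq_merged 0) (t := (T ord_max, false)));
    rewrite ?merged_T /= ?eqxx ?orbT //.
  by rewrite learn_root !inE eqxx orbT.
- by move=> s0 T0 D0 _; exists 0 => //; exact: same_segment0.
Qed.

(** Indices go down from [n - 1]: at the start of stage [i] every learned clause still contains
    [-t_j] for all [j <= i], which keeps the decided prefix free of unit clauses. *)
Lemma geq_stages r :
  r <= n ->
  exists iota, [/\ all_steps (@qcdcl_step Phi) [::] iota, size iota = 2 * r,
    forall C, C \in clauses_of iota -> learned_upto (n - r) C,
    geq_merged (n - r) \in clauses_of iota
  & forall TD, List.In TD iota -> size TD.1 <= #|{: geq_var}|.+1].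
Proof.
elim: r => [_|r IHr lt_rn].
  exists [::]; split=> //; first exact: all_steps_nil.
    move=> C /setUP[/geq_matrixP|]; last by rewrite inE.
    exact: LearnedAxiom.
  by apply/setUP; left; apply/geq_matrixP; rewrite subn0; constructor.
have [iota [iotaP size_iota psiP psiD sizeP]] := IHr (ltnW lt_rn).
have lt_i : n - r.+1 < n.+1 by lia.
pose i : index := Ordinal lt_i.
have iE : n - r = i.+1 by rewrite /=; lia.
have lt_in : i < n by rewrite /=; lia.
rewrite iE in psiP psiD.
exists (rcons (rcons iota (stage_decided i, geq_half i true))
          (stage_propagated i, geq_merged i)); split.
- apply: all_steps_rcons; last exact: stage_propagated_step.
  by apply: all_steps_rcons => //; exact: stage_decided_step.
- by rewrite !size_rcons size_iota; lia.
- move=> C /setUP[/geq_matrixP|]; first exact: LearnedAxiom.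
  rewrite inE /unzip2 !map_rcons !(mem_rcons, in_cons) => /or3P[/eqP->|/eqP->|Ci].
  + by apply: LearnedMerged; rewrite //= leq_subr.
  + exact: LearnedHalf.
  + have CP : C \in clauses_of iota by apply/setUP; right; rewrite inE.
    case: (psiP C CP) => [C' axC|m le_m le_mn|j le_j lt_jn].
    * exact: LearnedAxiom.
    * by apply: LearnedMerged => //; exact: ltnW.
    * by apply: LearnedHalf => //; exact: ltnW.
- by apply/setUP; right; rewrite inE /unzip2 map_rcons mem_rcons mem_head.
- move=> TD; rewrite -!cats1 -catA => inTD.
  have [/sizeP //|/=] := List.in_app_or _ _ _ inTD.
  by case=> [<-|[<-|[]]]; exact: size_stage_trail.
Qed.

Lemma geq_qcdcl_easy :
  exists2 iota, @qcdcl_proof Phi iota set0 &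
    @qcdcl_size Phi iota <= #|{: geq_var}| * #|{: geq_var}|.+1.
Proof.
have [iota [iotaP size_iota psiP psiD sizeP]] := geq_stages (leqnn n).
rewrite subnn in psiP psiD.
set final := [:: Propagated (Some (T ord_max, true)) geq_unit;
                 Propagated None (geq_merged 0)].
exists (rcons iota (final, set0)).
  split; first by exists iota, final.
  move=> s tr D s' sE.
  suff iotaP' : all_steps (@qcdcl_step Phi) [::] (rcons iota (final, set0)).
    exact: iotaP' sE.
  by apply: all_steps_rcons => //; exact: final_step.
(* There are [2 * n + 1] trails, each with at most one element more than there are variables. *)
apply: (@leq_trans (\sum_(TD <- rcons iota (final, set0)) #|{: geq_var}|.+1)).
  rewrite /qcdcl_size -!cats1 !big_cat /= !big_seq1 leq_add //; last first.
    by rewrite card_geq_var ltnS muln_gt0.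
  elim: iota sizeP {iotaP size_iota psiP psiD} => [|TD iota IH] sizeP.
    by rewrite !big_nil.
  rewrite !big_cons leq_add //; first by apply: sizeP; left.
  by apply: IH => TD' inTD'; apply: sizeP; right.
rewrite big_const_seq count_predT iter_addn_0 size_rcons size_iota mulnC.
by rewrite leq_mul2r card_geq_var; apply/orP; right; lia.
Qed.

End GuardedEquality.

(** * A family that is easy for Q-resolution and hard for QCDCL *)

Definition qres_step (Phi : qcnf) (s : seq (clause (qvar Phi)))
    (D : clause (qvar Phi)) : Prop :=
  [\/ D \in qmatrix Phi,
      exists C1 C2 l,
        [/\ C1 \in s, C2 \in s, existential l.1, resolvable l C1 C2 &
            D = resolvent l C1 C2 /\ ~~ tautological D]
    | exists2 C1, C1 \in s & D = red C1].

Definition qres_derivation (Phi : qcnf) (pi : seq (clause (qvar Phi))) : Prop :=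
  forall s D s', pi = s ++ D :: s' -> qres_step s D.

Lemma qres_derivation_rcons (Phi : qcnf) (pi : seq (clause (qvar Phi)))
    (D : clause (qvar Phi)) :
  qres_derivation pi -> qres_step pi D -> qres_derivation (rcons pi D).
Proof.
move=> piP stepD s D' s' piDE.
have [[-> -> _] //|[s'' piE]] := cat_cons_rcons piDE.
exact: piP piE.
Qed.

(** Induction along the learning derivation, with the position of every antecedent in the trail at
    hand. *)
Lemma learnable_ind (Phi : qcnf) (T : trail (qvar Phi))
    (G : clause (qvar Phi) -> Prop) :
  (forall s A s', T = s ++ Propagated None A :: s' -> G (red A)) ->
  (forall s p A s' C, T = s ++ Propagated (Some p) A :: s' -> G C ->
     G (learn_step C (p, A))) ->
  forall D, D \in learnable T -> G D.
Proof.
move=> G0 GS; rewrite /learnable.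
case revT: (rev T) => [|[d|[p|] A] R] // D.
have TE : T = rev R ++ [:: Propagated None A].
  by rewrite -[T]revK revT rev_cons cats1.
have GA := G0 _ _ _ TE.
have {G0} {}GS s p B s' C : R = s ++ Propagated (Some p) B :: s' -> G C ->
    G (learn_step C (p, B)).
  move=> RE; apply: (GS (rev s') _ _ (rev s ++ [:: Propagated None A])).
  by rewrite TE RE rev_cat rev_cons cat_rcons -catA.
move: (red A) GA; elim: R GS {revT TE} => [|e R IHR] GS C GC /=.
  by rewrite inE => /eqP->.
have {}IHR := IHR (fun s p B s' C RE => GS (e :: s) p B s' C (congr1 (cons e) RE)).
case: e GS IHR => [d|[p|] B] GS IHR /=; try exact: IHR.
rewrite inE => /predU1P[->//|]; apply: IHR.
exact: (GS [::] p B R).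
Qed.

Lemma mem_trail_lits (V : finType) (s : trail V) (l : lit V) :
  l \in trail_lits s ->
  exists r e r', s = r ++ e :: r' /\ elt_lit e = Some l.
Proof.
elim: s => //= e s IHs; rewrite /trail_lits /=.
case eE: (elt_lit e) => [h|] /=.
  rewrite inE => /predU1P[->|/IHs[r [e' [r' [-> e'E]]]]].
    by exists [::], e, s.
  by exists (e :: r), e', r'.
by case/IHs=> [r [e' [r' [-> e'E]]]]; exists (e :: r), e', r'.
Qed.

(** * The order trap formulas *)

Section OrderTrap.

Variable n : nat.

Local Notation index := 'I_n.+1.

(* [None] is the universal variable u, [Some (false, i)] is x_i in the first
   block, and [Some (true, i)] is t_i in the last one. *)
Definition trap_var : Type := option (bool * index).
HB.instance Definition _ := Finite.on trap_var.

Local Notation U := (None : trap_var).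
Local Notation X i := (Some (false, i) : trap_var).
Local Notation T i := (Some (true, i) : trap_var).

Definition trap_level (x : trap_var) : nat :=
  if x is Some (b, _) then if b then 2 else 0 else 1.

Definition trap_short (i : index) (b : bool) : clause trap_var :=
  [set (X i, b); (U, true); (T i, true)].

(** The matrix contains the case [m = 0]; the others are the intermediate clauses of the
    Q-resolution refutation, ending with the single literal [u] for [m = n.+1]. *)
Definition trap_long (m : nat) : clause trap_var :=
  [set l | (l == (U, true)) || [exists i : index, (m <= i) && (l == (T i, false))]].

Definition trap_matrix : {set clause trap_var} :=
  trap_long 0 |: [set trap_short ib.1 ib.2 | ib : index * bool].

Lemma mem_trap_short i b l :
  (l \in trap_short i b) = [|| l == (X i, b), l == (U, true) | l == (T i, true)].
Proof. by rewrite !inE orbA. Qed.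

Lemma trap_longT m i b : ((T i, b) \in trap_long m) = (m <= i) && ~~ b.
Proof.
rewrite inE /=; apply/existsP/andP=> [[j /andP[mj /eqP[-> ->]]]|[mi nb]] //.
by exists i; rewrite mi (negbTE nb) eqxx.
Qed.

Lemma trap_longX m i b : ((X i, b) \in trap_long m) = false.
Proof. by rewrite inE; apply/existsP=> -[j /andP[_ /eqP[]]]. Qed.

Lemma trap_longU m b : ((U, b) \in trap_long m) = b.
Proof. by case: b; rewrite inE //=; apply/existsP=> -[j /andP[_ /eqP[]]]. Qed.

Lemma mem_trap_matrix C :
  C \in trap_matrix -> C = trap_long 0 \/ exists i b, C = trap_short i b.
Proof.
by case/setU1P=> [->|/imsetP[[i b] _ ->]]; [left | right; exists i, b].
Qed.

Lemma trap_shortP i b : trap_short i b \in trap_matrix.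
Proof. by apply/setU1P; right; apply/imsetP; exists (i, b). Qed.

Lemma trap_long0P : trap_long 0 \in trap_matrix.
Proof. exact: setU11. Qed.

Lemma trap_long_nontaut m : ~~ tautological (trap_long m).
Proof.
apply: (@nontautological_of _ (fun x => x == U)) => -[[[[] i]|] b].
- by rewrite trap_longT => /andP[_ /negbTE->].
- by rewrite trap_longX.
- by rewrite trap_longU => ->.
Qed.

Lemma trap_nontaut C : C \in trap_matrix -> ~~ tautological C.
Proof.
case/mem_trap_matrix=> [->|[i [b ->]]]; first exact: trap_long_nontaut.
apply: (@nontautological_of _ (fun x => if x is Some (false, _) then b else true)).
by move=> l; rewrite mem_trap_short => /or3P[] /eqP->.
Qed.

Lemma trap_level_lt3 x : trap_level x < 3.
Proof. by case: x => [[[] i]|]. Qed.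

Lemma trap_level_onto i : i < 3 -> exists x, trap_level x = i.
Proof.
case: i => [|[|[|]]] // _; [by exists (X ord0) | by exists U |].
by exists (T ord0).
Qed.

Definition trap_qcnf : qcnf :=
  three_block_qcnf trap_level_lt3 trap_level_onto trap_nontaut.

Local Notation Phi := trap_qcnf.

Lemma trap_false : qcnf_false Phi.
Proof.
apply: three_block_false => a.
(* With [u] false, one clause of each short pair forces [t_i], and together these falsify the long
   clause. *)
exists (fun x => if x is None then false else a x) => [[]//|c cP sat_c].
have cX i : c (X i) = a (X i) by rewrite cP.
have cU : c U = false by rewrite cP.
have cT i : c (T i) = true.
  have [l] := sat_c _ (trap_shortP i (~~ a (X i))).
  rewrite mem_trap_short => /or3P[] /eqP-> //=; last by rewrite cU.
  by rewrite cX; case: (a _).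
have [[[[[] i]|] b]] := sat_c _ trap_long0P.
- by rewrite trap_longT cT /= => /negbTE->.
- by rewrite trap_longX.
- by rewrite trap_longU /= cU => ->.
Qed.

Lemma card_trap_var : #|{: trap_var}| = (2 * n.+1).+1.
Proof. by rewrite card_option card_prod card_bool card_ord. Qed.

Lemma trap_size : qcnf_size Phi <= 2 ^ 5 * n.+1 ^ 2.
Proof.
have cardM : #|qmatrix Phi| <= (2 * n.+1).+1.
  rewrite (leq_trans (leq_card_setU _ _)) // cards1 add1n ltnS.
  rewrite (leq_trans (leq_imset_card _ _)) // card_prod card_bool card_ord.
  by rewrite mulnC.
apply: leq_trans (qcnf_size_bound cardM) _.
rewrite card_trap_var -mulnn (_ : 2 ^ 5 = 32) //; nia.
Qed.

(** * Short Q-resolution refutations *)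

Lemma trap_resolve_short i (s : seq (clause trap_var)) :
  trap_short i true \in s -> trap_short i false \in s ->
  @qres_step Phi s [set (U, true); (T i, true)].
Proof.
move=> sT sF; apply: Or32.
exists (trap_short i true), (trap_short i false), (X i, true).
have resE : [set (U, true); (T i, true)] =
    resolvent (X i, true) (trap_short i true) (trap_short i false).
  apply/setP=> l; rewrite resolventP !mem_trap_short !inE.
  by case: l => [[[[] j]|] []]; rewrite ?xpair_eqE //= ?andbF ?andbT ?orbF ?orbb //;
    case: eqP.
split=> //; first by rewrite existential3E.
  by rewrite /resolvable !mem_trap_short !xpair_eqE /= !eqxx !andbF.
split=> //; apply: (@nontautological_of _ (fun=> true)) => l.
by rewrite !inE => /orP[] /eqP->.
Qed.

Lemma trap_resolve_long (i : index) (s : seq (clause trap_var)) :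
  [set (U, true); (T i, true)] \in s -> trap_long i \in s ->
  @qres_step Phi s (trap_long i.+1).
Proof.
move=> s1 s2; apply: Or32.
exists [set (U, true); (T i, true)], (trap_long i), (T i, true).
have resE : trap_long i.+1 =
    resolvent (T i, true) [set (U, true); (T i, true)] (trap_long i).
  apply/setP=> -[[[[] j]|] b]; rewrite resolventP.
  - rewrite !trap_longT !inE !xpair_eqE /=.
    case: b; rewrite ?andbF ?andbT ?orbF /=.
      by rewrite andNb.
    rewrite ltn_neqAle; congr (_ && _).
    by rewrite eq_sym /eq_op /= /eq_op.
  - by rewrite !trap_longX !inE !xpair_eqE andbF.
  - by rewrite !trap_longU !inE !xpair_eqE /=; case: b.
split=> //; first by rewrite existential3E.
  by rewrite /resolvable !trap_longT !inE !xpair_eqE /= !eqxx leqnn.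
by split=> //; exact: trap_long_nontaut.
Qed.

(** Each index costs four lines: two short clauses, their resolvent on [x_i], and its resolvent with
    the long clause on [t_i]. *)
Lemma trap_derive_long m :
  m <= n.+1 ->
  exists2 pi, @qres_derivation Phi pi /\ trap_long m \in pi & size pi = 4 * m + 1.
Proof.
elim: m => [_|m IHm lt_mn].
  exists [:: trap_long 0]; last by [].
  split; last by rewrite inE.
  apply: (@qres_derivation_rcons Phi [::]) => [[]//|].
  by apply: Or31; exact: trap_long0P.
have [pi [piP Lm] size_pi] := IHm (ltnW lt_mn).
pose i : index := Ordinal lt_mn.
pose pi1 := rcons pi (trap_short i true).
pose pi2 := rcons pi1 (trap_short i false).
pose pi3 := rcons pi2 [set (U, true); (T i, true)].
exists (rcons pi3 (trap_long m.+1)); last by rewrite !size_rcons size_pi; lia.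
split; last by rewrite mem_rcons mem_head.
have pi1P : @qres_derivation Phi pi1.
  by apply: qres_derivation_rcons piP _; apply: Or31; exact: trap_shortP.
have pi2P : @qres_derivation Phi pi2.
  by apply: qres_derivation_rcons pi1P _; apply: Or31; exact: trap_shortP.
have pi3P : @qres_derivation Phi pi3.
  apply: qres_derivation_rcons pi2P _; apply: trap_resolve_short.
    by rewrite /pi2 /pi1 !(mem_rcons, in_cons) eqxx orbT.
  by rewrite /pi2 mem_rcons mem_head.
apply: qres_derivation_rcons pi3P _; apply: (@trap_resolve_long i).
  by rewrite /pi3 mem_rcons mem_head.
by rewrite /pi3 /pi2 /pi1 !(mem_rcons, in_cons) Lm !orbT.
Qed.

Lemma trap_qres_easy :
  exists2 pi : seq (clause trap_var), @qres_proof Phi pi set0 &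
    size pi = 2 * #|{: trap_var}|.
Proof.
have [pi [piP Ln] size_pi] := trap_derive_long (leqnn n.+1).
exists (rcons pi set0); last by rewrite size_rcons size_pi card_trap_var; lia.
split; first by exists pi.
apply: qres_derivation_rcons piP _; apply: Or33; exists (trap_long n.+1) => //.
apply/setP=> l; rewrite mem_red3 in_set0.
case: l => [[[[] j]|] b] /=.
- by rewrite trap_longT leqNgt ltn_ord.
- by rewrite trap_longX.
- apply/esym/negP=> /andP[_] /exists_inP[[[[[] j]|] c]] //.
  by rewrite trap_longT leqNgt ltn_ord.
Qed.

(** * The invariant of QCDCL on the order trap *)

Implicit Types (p : lit trap_var) (K : {set {ffun index -> bool}}).
Implicit Types (A B C D E : clause trap_var).

Definition xfalsifies (al : {ffun index -> bool}) C : bool :=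
  [forall i, (X i, al i) \notin C].

Definition no_T C : Prop := forall i b, (T i, b) \notin C.

(** A weak substitute for [C] containing a literal of [x_i]: the assignments outside [K] that
    falsify its first-block part determine [x_i]. If this holds for all [i], at most one such
    assignment exists. *)
Definition agree_on K C (i : index) : Prop :=
  forall al be, al \notin K -> be \notin K ->
    xfalsifies al C -> xfalsifies be C -> al i = be i.

Definition positive_shape K C (i : index) : Prop :=
  [/\ (T i, true) \in C, forall j b, (T j, b) \in C -> j = i /\ b = true
    & agree_on K C i].

Definition negative_shape K C : Prop :=
  (forall j, (T j, true) \notin C) /\
  forall j, (T j, false) \in C \/ agree_on K C j.

(* K collects the assignments of the first block excluded so far. Resolution on
   t_i combines a positive with a negative shape into a negative one, and
   resolution on x_i only uses clauses that no assignment outside K falsifies, so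
   it preserves the shape. *)
Definition shaped K C : Prop :=
  [/\ (U, false) \notin C, forall i b, (T i, b) \in C -> (U, true) \in C
    & (exists i, positive_shape K C i) \/ negative_shape K C].

Definition excluded K C : Prop :=
  no_T C -> forall al, al \notin K -> ~~ xfalsifies al C.

Definition trap_invariant K (psi : {set clause trap_var}) : Prop :=
  forall C, C \in psi -> shaped K C /\ excluded K C.

Lemma xfalsifies_sub al C D :
  (forall i b, (X i, b) \in D -> (X i, b) \in C) ->
  xfalsifies al C -> xfalsifies al D.
Proof.
move=> DC /forallP alC; apply/forallP=> i.
by apply: contra (alC i); exact: DC.
Qed.

Lemma agree_on_sub K C D i :
  (forall al, al \notin K -> xfalsifies al C -> xfalsifies al D) ->
  agree_on K D i -> agree_on K C i.
Proof. by move=> CD agD al be alK beK alC beC; apply: agD; auto. Qed.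

Lemma agree_on_mono K K' C i :
  K \subset K' -> agree_on K C i -> agree_on K' C i.
Proof.
move=> /subsetP KK' ag al be alK beK; apply: ag.
- by apply: contra alK; exact: KK'.
- by apply: contra beK; exact: KK'.
Qed.

Lemma shaped_mono K K' C : K \subset K' -> shaped K C -> shaped K' C.
Proof.
move=> KK' [uC tC shC]; split=> //; case: shC => [[i [iC posC agC]]|[negC agC]].
  by left; exists i; split=> //; exact: agree_on_mono agC.
right; split=> // j; case: (agC j) => [|ag]; [by left | right].
exact: agree_on_mono ag.
Qed.

(** Covers the operations that keep the last-block literals: reduction, and resolution on some
    [x_i]. *)
Lemma shaped_congr K C D :
  (forall i b, ((T i, b) \in D) = ((T i, b) \in C)) ->
  (forall al, al \notin K -> xfalsifies al D -> xfalsifies al C) ->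
  (U, false) \notin D ->
  (forall i b, (T i, b) \in C -> (U, true) \in C -> (U, true) \in D) ->
  shaped K C -> shaped K D.
Proof.
move=> TE fals uD UD [uC tC shC]; split=> //.
  by move=> i b; rewrite TE => tiC; apply: UD (tiC) (tC _ _ tiC).
case: shC => [[i [iC posC agC]]|[negC agC]].
  left; exists i; split; rewrite ?TE //; first by move=> j b; rewrite TE => /posC.
  exact: agree_on_sub agC.
right; split=> [j|j]; rewrite TE //; case: (agC j) => [|ag]; [by left | right].
exact: agree_on_sub ag.
Qed.

Lemma shaped_red K C : shaped K C -> shaped K (@red Phi C).
Proof.
move=> shC; apply: shaped_congr (shC) => [i b|al _|| i b tC uC].
- by rewrite mem_red3 andbT.
- by apply: xfalsifies_sub => i b; rewrite mem_red3 andbT.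
- by case: shC => + _ _; apply: contra; exact/subsetP/red3_sub.
- by rewrite (red3_id tC).
Qed.

(** [t_i] in [C] implies positive shape and [-t_i] in [D] negative shape. The resolvent loses [-t_i]
    but inherits agreement at [i] from [C]; at other indices [D] supplies the literal or the
    agreement. *)
Lemma shaped_resolve_T K C D E i :
  shaped K C -> shaped K D -> (T i, true) \in C -> (T i, false) \in D ->
  (forall l, (l \in E) =
     (l != (T i, true)) && (l \in C) || (l != (T i, false)) && (l \in D)) ->
  shaped K E.
Proof.
move=> [uC tC shC] [uD tD shD] iC iD EE; split.
- by rewrite EE (negbTE uC) (negbTE uD) !andbF.
- by move=> j b _; rewrite EE (tC _ _ iC).
have [posC agC] :
    (forall j b, (T j, b) \in C -> j = i /\ b = true) /\ agree_on K C i.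
  case: shC => [[i' [_ posC agC]]|[/(_ i)]]; last by rewrite iC.
  by have [ii' _] := posC _ _ iC; rewrite ii'.
have [negD agD] : negative_shape K D.
  by case: shD => // -[i' [_ posD _]]; have [] := posD _ _ iD.
have falsC al : xfalsifies al E -> xfalsifies al C.
  by apply: xfalsifies_sub => j b jC; rewrite EE jC.
have falsD al : xfalsifies al E -> xfalsifies al D.
  by apply: xfalsifies_sub => j b jD; rewrite EE jD orbT.
right; split=> j.
  rewrite EE (negbTE (negD j)) andbF orbF; apply/negP=> /andP[ne_j /posC[ji _]].
  by rewrite ji eqxx in ne_j.
case: (agD j) => [jD|agDj]; last by right; apply: agree_on_sub agDj => al _; auto.
have [->|ne_ji] := eqVneq j i.
  by right; apply: agree_on_sub agC => al _; auto.
left; rewrite EE jD andbT; apply/orP; right; apply: contra ne_ji.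
by case/eqP=> ->.
Qed.

(** Decisions outside the first block obey LEV-ORD. A propagated literal of some [t_i] has an
    antecedent containing [u], which cannot be reduced there and so was falsified before. *)
Lemma trap_X_assigned K psi (tr : trail trap_var) s e s' l C m :
  trap_invariant K psi -> @is_trail Phi psi tr -> tr = s ++ e :: s' ->
  elt_lit e = Some l -> trap_level l.1 != 0 ->
  C \in psi -> m \in C -> trap_level m.1 = 0 ->
  m.1 \in [seq h.1 | h <- trail_lits s].
Proof.
move=> invK [_ trP] trE el kl Cpsi mC km.
have decided r d r' : tr = r ++ Decision d :: r' -> trap_level d.1 != 0 ->
    m.1 \in [seq h.1 | h <- trail_lits r].
  move=> /trP/(_ C m Cpsi mC) dP kd; apply: contraT => /dP.
  by rewrite !lv3E km leqNgt; case: (trap_level _) kd.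
case: e el trE => [d [dl]|[p|] A // [pl]] trE; first by apply: decided trE _; rewrite dl.
rewrite pl in trE => {p pl}.
have [unitA _] := trP _ _ _ trE.
have [lA kl1] := unit_mem unitA.
case: l kl kl1 lA unitA trE => -[[[] i]|] b // _ _ lA unitA trE.
have [[_ tA _] _] := invK A (proj1 unitA).
have : neg_lit (U, true) \in trail_lits s.
  by apply: unit_falsified unitA (tA _ _ lA) _ _.
rewrite /neg_lit /= => uS.
(* The element falsifying [u] must be a decision, since universal literals are never propagated;
   this leads back to the first case. *)
have [r [e [r' [sE eE]]]] := mem_trail_lits uS.
rewrite sE -catA /= in trE.
rewrite sE /trail_lits pmap_cat map_cat mem_cat; apply/orP; left.
case: e eE trE {sE} => [d [dE]|[p|] B // [pE]] trE.
  by apply: decided trE _; rewrite dE.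
have [unitB _] := trP _ _ _ trE.
by have [] := unit_mem unitB; rewrite pE.
Qed.

(** A last-block literal of [A] would have been falsified earlier, hence after all first-block
    variables of [A] were assigned; then the variable of [p] would occur twice in the trail. *)
Lemma trap_X_antecedent K psi (tr : trail trap_var) s p A s' :
  trap_invariant K psi -> @is_trail Phi psi tr ->
  tr = s ++ Propagated (Some p) A :: s' -> trap_level p.1 = 0 -> no_T A.
Proof.
move=> invK trP trE kp i b; apply/negP=> tA.
have [unitA _] := proj2 trP _ _ _ trE.
have [pA kp1] := unit_mem unitA.
have tp : (T i, b) != p by apply/eqP=> tp; rewrite -tp in kp.
have := unit_falsified unitA tA tp isT; rewrite /neg_lit /= => ts.
have [r [e [r' [sE eE]]]] := mem_trail_lits ts.
have : p.1 \in [seq h.1 | h <- trail_lits r].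
  apply: (@trap_X_assigned K psi tr r e (r' ++ Propagated (Some p) A :: s')
           (T i, ~~ b) A p) => //.
    by rewrite trE sE -catA.
  by case: unitA.
move=> pr; have [+ _] := trP.
rewrite trE sE /trail_lits !pmap_cat !map_cat cat_uniq.
case/and3P=> _ /hasPn/(_ p.1) /=; rewrite inE eqxx => /(_ isT).
by rewrite mem_cat pr.
Qed.

Lemma shaped_learn_step K psi (tr : trail trap_var) s p A s' C :
  trap_invariant K psi -> @is_trail Phi psi tr ->
  tr = s ++ Propagated (Some p) A :: s' ->
  shaped K C -> shaped K (@learn_step Phi C (p, A)).
Proof.
move=> invK trP trE shC; rewrite /learn_step; case: ifP => // npC.
have [unitA _] := proj2 trP _ _ _ trE.
have [pA kp] := unit_mem unitA.
have [shA exA] := invK A (proj1 unitA).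
apply: shaped_red; case: p pA kp npC unitA trE => -[[[] i]|] b /= pA kp npC unitA trE //.
- rewrite (red3_id pA) //; case: b pA npC {unitA kp trE} => pA npC.
    by apply: (shaped_resolve_T shA shC pA npC) => l; rewrite resolventP.
  by apply: (shaped_resolve_T shC shA npC pA) => l; rewrite resolventP orbC.
have noT : no_T A by exact: trap_X_antecedent invK trP trE erefl.
have TE j c : ((T j, c) \in resolvent (X i, b) (@red Phi A) C) = ((T j, c) \in C).
  by rewrite resolventP mem_red3 (negbTE (noT j c)) andbF.
apply: shaped_congr (shC) => //.
(* If [al] falsifies the resolvent but not [C], the literal of [C] true under [al] is the negated
   pivot. By [exA] some literal of [A] is also true under [al], and it can only be the pivot, a
   contradiction. *)
- move=> al alK /forallP falsR; apply/forallP=> j; apply/negP=> jC.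
  have := exA noT al alK; rewrite negb_forall => /existsP[h]; rewrite negbK => hA.
  have := falsR j; rewrite resolventP jC andbT negb_or negbK => /andP[_ /eqP[ji alj]].
  have := falsR h; rewrite resolventP mem_red3 hA /= andbT negb_or negbK.
  case/andP=> /eqP[hi alh] _.
  by move: alj; rewrite ji -{1}hi alh; case: (b).
- case: shC shA => uC _ _ [uA _ _]; rewrite resolventP negb_or.
  rewrite !negb_and uC orbT andbT; apply/orP; right.
  by apply: contra uA; exact/subsetP/red3_sub.
- by move=> j c _ uC; rewrite resolventP uC orbT.
Qed.

Lemma shaped_learnable K psi (tr : trail trap_var) D :
  trap_invariant K psi -> @is_trail Phi psi tr ->
  D \in @learnable Phi tr -> shaped K D.
Proof.
move=> invK trP; apply: learnable_ind => [s A s' trE|s p A s' C trE].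
  have [[Apsi _] _] := proj2 trP _ _ _ trE.
  by apply: shaped_red; case: (invK A Apsi).
exact: (shaped_learn_step invK trP trE).
Qed.

(** If [D] has a last-block literal, [K] stays. Otherwise its shape gives agreement at every index,
    so [F] has at most one element. *)
Lemma trap_invariant_learn K psi D :
  trap_invariant K psi -> shaped K D ->
  exists2 K' : {set {ffun index -> bool}},
    trap_invariant K' (psi :|: [set D]) & #|K'| <= #|K|.+1.
Proof.
move=> invK shD; pose F := [set al | xfalsifies al D & al \notin K].
have [/existsP[i /existsP[b tD]]|noT] := boolP [exists i, exists b, (T i, b) \in D].
  exists K => // C /setUP[/invK//|/set1P->]; split=> // noT.
  by case/negP: (noT i b).
have {}noT : no_T D.
  move=> i b; apply: contra noT => tD; apply/existsP; exists i.
  by apply/existsP; exists b.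
exists (K :|: F).
  move=> C /setUP[/invK[shC exC]|/set1P->].
    split; first exact: shaped_mono (subsetUl _ _) shC.
    by move=> noTC al; rewrite inE negb_or => /andP[alK _]; exact: exC.
  split; first exact: shaped_mono (subsetUl _ _) shD.
  move=> _ al; rewrite !inE negb_or negb_and => /andP[alK].
  by rewrite alK orbF.
have ag : forall j, agree_on K D j.
  case: shD => _ _ [[i [iD _ _]]|[_ agD] j]; first by case/negP: (noT i true).
  by case: (agD j) => // jD; case/negP: (noT j false).
rewrite (leq_trans (leq_card_setU _ _)) // -(addn1 #|K|) leq_add2l.
apply/card_le1_eqP => al be; rewrite !inE => /andP[alD alK] /andP[beD beK].
by apply/ffunP=> j; exact: ag.
Qed.

Lemma trap_invariant_init : trap_invariant set0 trap_matrix.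
Proof.
move=> C /mem_trap_matrix[->|[i [b ->]]]; split.
- split=> [|i b _|]; rewrite ?trap_longU //; right; split=> j; rewrite trap_longT //.
  by left.
- by move=> /(_ ord0 false); rewrite trap_longT.
- split; rewrite ?mem_trap_short ?xpair_eqE //=.
  left; exists i; split; first by rewrite mem_trap_short eqxx !orbT.
    by move=> j c; rewrite mem_trap_short => /or3P[] // /eqP[-> ->].
  move=> al be _ _ /forallP/(_ i) + /forallP/(_ i).
  rewrite !mem_trap_short !negb_or => /andP[+ _] /andP[+ _].
  by rewrite !xpair_eqE !eqxx /=; case: (al i) (be i) (b) => [] [] [].
- by move=> /(_ i true); rewrite mem_trap_short eqxx !orbT.
Qed.

Lemma trap_qcdcl_invariant (iota : seq (trail trap_var * clause trap_var)) :
  (forall s tr D s', iota = s ++ (tr, D) :: s' ->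
     let psi := trap_matrix :|: [set B in unzip2 s] in
     @is_trail Phi psi tr /\ D \in @learnable Phi tr) ->
  exists2 K : {set {ffun index -> bool}},
    trap_invariant K (trap_matrix :|: [set B in unzip2 iota]) & #|K| <= size iota.
Proof.
elim/last_ind: iota => [_|iota [tr D] IH iotaP].
  exists set0; last by rewrite cards0.
  by move=> C /setUP[/trap_invariant_init|]; rewrite ?inE.
have [s tr' D' s' iotaE|K invK leK] := IH.
  by apply: (iotaP s tr' D' (rcons s' (tr, D))); rewrite iotaE rcons_cat.
have [trP learnD] := iotaP iota tr D [::] (esym (cats1 _ _)).
have [K' invK' leK'] := trap_invariant_learn invK (shaped_learnable invK trP learnD).
exists K'; last by rewrite size_rcons; exact: leq_trans leK' _.
move=> C CP; apply: invK'; move: CP; rewrite /unzip2 map_rcons /=.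
case/setUP=> [CM|]; first by apply/setUP; left; apply/setUP; left.
rewrite inE mem_rcons in_cons => /predU1P[->|Ci]; first exact/setUP/or_intror/set11.
by apply/setUP; left; apply/setUP; right; rewrite inE.
Qed.

Lemma trap_qcdcl_hard (iota : seq (trail trap_var * clause trap_var)) :
  @qcdcl_proof Phi iota set0 -> 2 ^ n.+1 <= @qcdcl_size Phi iota.
Proof.
case=> -[s0 [tr0 iotaE]] iotaP.
have [s tr D s' /iotaP[] //|K invK leK] := @trap_qcdcl_invariant iota.
(* The learned empty clause is falsified by every assignment, so none is left outside [K]. *)
have KT : K = setT.
  apply/setP=> al; rewrite inE; apply: contraT => alK.
  have noT : no_T set0 by move=> i b; rewrite inE.
  have [|_ /(_ noT al alK)/negP[]] := invK set0.
    by rewrite iotaE /unzip2 map_rcons !inE mem_rcons mem_head orbT.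
  by apply/forallP=> i; rewrite inE.
have -> : 2 ^ n.+1 = #|K| by rewrite KT cardsT card_ffun card_bool card_ord.
apply: leq_trans leK _; rewrite /qcdcl_size.
(* Size counts trail elements, and each trail contains at least its conflict symbol. *)
have: forall s tr D s', iota = s ++ (tr, D) :: s' -> 0 < size tr.
  move=> s tr D s' /iotaP[_ [r [A ->]] _ _ _].
  by rewrite size_rcons.
elim: iota {iotaP iotaE invK} => [|[tr D] iota IH] sizeP; first by rewrite big_nil.
rewrite big_cons /= -add1n leq_add //; first exact: (sizeP [::] tr D iota).
by apply: IH => s tr' D' s' iotaE; apply: (sizeP ((tr, D) :: s) tr' D' s'); rewrite iotaE.
Qed.

End OrderTrap.

(** * The two separations combined *)

Theorem theorem4p8 :
  (~ simulates Qresolution QCDCL_LEVORD_RED /\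
   ~ simulates QCDCL_LEVORD_RED Qresolution) /\
  (exists Phi : nat -> qcnf,
     [/\ forall n, qcnf_false (Phi n),
         poly_size_refutations QCDCL_LEVORD_RED Phi
       & ~ poly_size_refutations Qresolution Phi]) /\
  (exists Phi : nat -> qcnf,
     [/\ forall n, qcnf_false (Phi n),
         poly_size_refutations Qresolution Phi
       & ~ poly_size_refutations QCDCL_LEVORD_RED Phi]).
Proof.
have card_le (Phi : qcnf) : #|qvar Phi| <= qcnf_size Phi.
  by rewrite /qcnf_size -addnA leq_addr.
have geq_easy : poly_size_refutations QCDCL_LEVORD_RED geq_qcnf.
  (* This is the bound [N * (N + 1)] for [N] variables, and [N] is at most the formula size. *)
  exists ('X^2 + 'X)%R => n; have [iota iotaP le_iota] := geq_qcdcl_easy n.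
  exists iota => //; apply: leq_trans le_iota _.
  rewrite hornerD hornerXn hornerX natrXE mulnS addnC mulnn.
  by apply: leq_add; rewrite ?leq_exp2r //; exact: card_le (geq_qcnf n).
have geq_hard : ~ poly_size_refutations Qresolution geq_qcnf.
  by apply: not_poly_size_refutations geq_size _ => n pi; exact: geq_qres_hard.
have trap_easy : poly_size_refutations Qresolution trap_qcnf.
  exists ('X + 'X)%R => n; have [pi piP size_pi] := trap_qres_easy n.
  exists pi => //=; rewrite size_pi hornerD hornerX mul2n -addnn.
  by apply: leq_add; exact: card_le (trap_qcnf n).
have trap_hard : ~ poly_size_refutations QCDCL_LEVORD_RED trap_qcnf.
  apply: not_poly_size_refutations trap_size _ => n iota /trap_qcdcl_hard.
  by apply: leq_trans; rewrite leq_exp2l.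
split; last by split; [exists geq_qcnf | exists trap_qcnf];
  split=> // n; [exact: geq_false | exact: trap_false].
by split; [exact: separation_not_simulates geq_easy geq_hard
          | exact: separation_not_simulates trap_easy trap_hard].
Qed.
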